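(* Let $N\geq 1$ and consider the generic filtering algorithm described in the context, where $\big(\{U_{t,2}^n\}_{n=1}^N\big)_{t\geq 1}$ is a sequence of independent sets of $N$ independent $\mathcal{U}(0,1)$ random variables. Then, for every interval $[a,b]\subset\mathbb{R}$, $$\mathbb{P}\big(\hat{\eta}_t^N([a,b])=0 \text{ for infinitely many } t\big)=\mathbb{P}\big(\eta_t^N([a,b])=0 \text{ for infinitely many } t\big)=1,$$ and, for every $\kappa\in(0,1)$, $$\mathbb{P}\big(\|\hat{\eta}_t^N-\hat{\eta}_t\|_{\mathrm{D}}\geq \kappa \text{ for infinitely many } t\big)=\mathbb{P}\big(\|\eta_t^N-\eta_t\|_{\mathrm{D}}\geq \kappa \text{ for infinitely many } t\big)=1.$$
   Context: $\mathcal{P}(\mathbb{R})$ is the set of Borel probability measures on $\mathbb{R}$. For $\pi\in\mathcal{P}(\mathbb{R})$, $F_\pi$ is its cumulative distribution function and $F_\pi^{-1}$ the generalized inverse of $F_\pi$. For $\pi_1,\pi_2\in\mathcal{P}(\mathbb{R})$, $\|\pi_1-\pi_2\|_{\mathrm{D}}=\sup_{-\infty<a<b<\infty}|\pi_1([a,b])-\pi_2([a,b])|$. For a measure $\pi$, function $f$ and kernel $K$ on $\mathbb{R}$: $\pi(f)=\int f\,d\pi$, $\pi K(A)=\int K(x,A)\pi(dx)$. Model. Fix $\rho\in\mathbb{R}$, $\sigma,c\in(0,\infty)$ and $\eta_1\in\mathcal{P}(\mathbb{R})$. For $z\in\mathbb{R}$ let $M(z,dx)=\mathcal{N}(\rho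 z,\sigma^2)$, $G(z)=e^{-cz^2/2}$ and $Q(z,dx)=M(z,dx)G(x)$; $Q^1=Q$ and $Q^k(x,A)=\int Q(x,dx')Q^{k-1}(x',A)$ for $k\ge2$. Define $\hat\eta_1(dx)=G(x)\eta_1(dx)/\eta_1(G)$ and, for $t\geq 2$, $\eta_t=\hat\eta_{t-1}M$ and $\hat\eta_t(dx)=\hat\eta_1Q^{t-1}(dx)/\hat\eta_1Q^{t-1}(\mathbb{R})$. Generic filtering algorithm. Given $N\ge1$ and random point sets $\{U_t^n=(U_{t,1}^n,U_{t,2}^n)\}_{n=1}^N$ in $(0,1)^2$, $t\geq 1$, all defined on a probability space $(\Omega,\mathcal{F},\mathbb{P})$: set $X_1^n=F_{\eta_1}^{-1}(U_{1,1}^n)$. For $t\geq 2$ set $\hat X_{t-1}^n=F^{-1}_{\hat\eta_{t-1}^N}(U_{t,1}^n)$ and $X_t^n=F^{-1}_{M(\hat X_{t-1}^n,dx)}(U_{t,2}^n)$. For all $t\geq 1$, $W_t^n=G(X_t^n)/\sum_{m=1}^NG(X_t^m)$, $\eta_t^N=\frac1N\sum_{n=1}^N\delta_{\{X_t^n\}}$ and $\hat\eta_t^N=\sum_{n=1}^NW_t^n\delta_{\{X_t^n\}}$. (Operations with index $n$ are performed for all $n\in\{1,\dots,N\}$.) *)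

(* Defs.v *)
From HB Require Import structures.
From mathcomp Require Import all_boot all_order all_algebra.
From mathcomp Require Import all_classical all_reals all_analysis.
Import Order.TTheory GRing.Theory Num.Theory.
Import numFieldNormedType.Exports.
Set Implicit Arguments.
Unset Strict Implicit.
Unset Printing Implicit Defensive.
Local Open Scope classical_set_scope.
Local Open Scope ring_scope.
Local Open Scope ereal_scope.

(* Measures on the line are handled as set functions; only their
   values on Borel sets matter.
   Time is indexed from 0: index [t] of every sequence below ([U1], [U2],
   [particles], [predictive], [filtering]) is time t + 1 of the model. *)

Section LineMeasures.
Context {R : realType}.
Implicit Types (mu nu : set (measurableTypeR R) -> \bar R)
  (K : R -> set R -> \bar R).

Definition mcdf mu (x : R) : \bar R := mu `]-oo, x]%classic.

Definition mquantile mu (u : R) : R := inf [set x | u%:E <= mcdf mu x].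

Definition discrepancy mu nu : \bar R :=
  ereal_sup [set r | exists a b : R,
    (a < b)%R /\ r = `|mu `[a, b]%classic - nu `[a, b]%classic|].

Definition apply_kernel mu K : set R -> \bar R :=
  fun A => \int[mu]_x K x A.

End LineMeasures.

Section Model.
Context {R : realType}.
Variables (rho sigma c : R) (eta1 : set (measurableTypeR R) -> \bar R).

(* [normal_prob] takes the standard deviation, not the variance. *)
Definition Mker (z : R) : set (measurableTypeR R) -> \bar R :=
  normal_prob (rho * z) sigma.

Definition Gpot (z : R) : R := expR (- (c * z ^+ 2 / 2)).

Definition Qker (z : R) (A : set R) : \bar R :=
  \int[Mker z]_(x in A) (Gpot x)%:E.

(* [Qpow k] is the (k + 1)-st power of [Qker]. *)
Fixpoint Qpow (k : nat) : R -> set R -> \bar R :=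
  if k is j.+1 then fun x => apply_kernel (Qker x) (Qpow j) else Qker.

Definition filter1 (A : set R) : \bar R :=
  (\int[eta1]_(x in A) (Gpot x)%:E) / (\int[eta1]_x (Gpot x)%:E).

Definition filtering (t : nat) : set R -> \bar R :=
  if t is s.+1 then
    fun A => apply_kernel filter1 (Qpow s) A /
             apply_kernel filter1 (Qpow s) [set: R]
  else filter1.

Definition predictive (t : nat) : set R -> \bar R :=
  if t is s.+1 then apply_kernel (filtering s) Mker else eta1.

Section Particles.
Variable N : nat.

Definition weight (X : 'I_N -> R) (n : 'I_N) : R :=
  (Gpot (X n) / \sum_(m < N) Gpot (X m))%R.

Definition empirical (X : 'I_N -> R) (A : set R) : \bar R :=
  (N%:R^-1)%:E * \sum_(n < N) \d_(X n) A.

Definition weighted_empirical (X : 'I_N -> R) (A : set R) : \bar R :=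
  \sum_(n < N) (weight X n)%:E * \d_(X n) A.

(* The particles driven by the points (u1 t n, u2 t n); [u2] at index 0 is
   not used. *)
Fixpoint particles (u1 u2 : nat -> 'I_N -> R) (t : nat) : 'I_N -> R :=
  if t is s.+1 then
    fun n =>
      let Xhat := mquantile (weighted_empirical (particles u1 u2 s)) (u1 t n) in
      mquantile (Mker Xhat) (u2 t n)
  else fun n => mquantile eta1 (u1 t n).

End Particles.
End Model.

Section Probability.
Context d {Omega : measurableType d} {R : realType} (P : probability Omega R).

Definition independent_systems (I : eqType) (F : I -> set_system Omega) : Prop :=
  forall (s : seq I) (A : I -> set Omega),
    uniq s -> (forall i, i \in s -> F i (A i)) ->
    P (\bigcap_(i in [set` s]) A i) = \prod_(i <- s) P (A i).

Definition independent_sets_of_uniforms (N : nat)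
    (U : nat -> 'I_N -> {RV P >-> R}) : Prop :=
  [/\ forall t n A, measurable A ->
        distribution P (U t n) A = uniform_prob (@ltr01 R) A,
      forall t, independent_systems
        (fun n : 'I_N => g_sigma_algebra_preimage (U t n)) &
      independent_systems
        (fun t : nat => g_sigma_preimage (fun n : 'I_N => U t n : Omega -> R))].

Definition infinitely_often (E : nat -> set Omega) : set Omega :=
  [set w | infinite_set [set t | E t w]].

End Probability.

(* Main.v *)
(* The resampling points U1 may depend on everything, including the mutation
   points U2, so the argument only uses events of U2. The mutation step moves
   a particle from z to rho z plus a normal increment determined by its U2
   point. Prescribe, over N + 1 successive times, narrow windows for these
   increments, centred at a fast growing deterministic sequence. Whatever the
   resampling does, each particle then follows up to a bounded error one of
   the N deterministic paths started at the particles present at the beginning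
   of the block, and such a path can visit [-B, B] at most once. By the
   pigeonhole principle, at one of the N + 1 times no particle lies in [-B, B].
   Blocks are independent with the same positive probability, hence infinitely
   many of them occur almost surely.

   For the discrepancy it remains to choose B such that the exact filters and
   predictors charge [-B, B] uniformly in time. The iterates of Q are
   explicit: Q^k (z, .) is W exp (- b z^2 / 2) N (a z, s^2), with s and a
   bounded in k. The filter is thus a Gaussian mixture whose mixing measure is
   a tilt of the first filter by exp (- b x^2 / 2), which only moves mass
   towards 0.

   The events have to be measurable for their probability to be meaningful: the
   discrepancy is a supremum over intervals with rational endpoints. *)
Require Import Defs.
From HB Require Import structures.
From mathcomp Require Import all_boot all_order all_algebra.
From mathcomp Require Import all_classical all_reals all_analysis.
From mathcomp Require Import measurable_realfun ring lra.
Import Order.TTheory GRing.Theory Num.Theory.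
Import numFieldNormedType.Exports.
Set Implicit Arguments.
Unset Strict Implicit.
Unset Printing Implicit Defensive.
Local Open Scope classical_set_scope.
Local Open Scope ring_scope.
Local Open Scope ereal_scope.

(** * Measures with a density and mixtures *)

Lemma measure_of_sigma_additive d (T : measurableType d) (R : realType)
    (f : set T -> \bar R) :
  f set0 = 0 -> (forall A, 0 <= f A) -> semi_sigma_additive f ->
  exists nu : {measure set T -> \bar R}, forall A, nu A = f A.
Proof.
move=> f0 fge0 fsa.
pose m := isMeasure.Build _ _ _ f f0 fge0 fsa.
pose nu : {measure set T -> \bar R} := HB.pack f m.
by exists nu.
Qed.

Section MeasureGeneralities.
Context d (T : measurableType d) (R : realType).

Lemma density_measure (mu : {measure set T -> \bar R}) (g : T -> R) :
  measurable_fun setT g -> (forall x, (0 <= g x)%R) ->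
  exists nu : {measure set T -> \bar R},
    forall A, nu A = \int[mu]_(x in A) (g x)%:E.
Proof.
move=> mg g0; apply: measure_of_sigma_additive => [|A|F mF tF mUF].
- by rewrite integral_set0.
- by apply: integral_ge0 => x _; rewrite lee_fin.
- rewrite ge0_integral_bigcup//; last 2 first.
  + by apply/measurable_EFinP; exact: measurable_funTS.
  + by move=> x _; rewrite lee_fin.
  apply: is_cvg_ereal_nneg_natsum_cond => n _ _.
  by apply: integral_ge0 => x _; rewrite lee_fin.
Qed.

(** Serves the filter, with a Gaussian tilt as [w], and the predictor, with [w] constant equal to
    1. *)
Lemma mixture_measure d' (S : measurableType d') (mu : {measure set T -> \bar R})
    (w : T -> R) (K : T -> {measure set S -> \bar R}) :
  measurable_fun setT w -> (forall x, (0 <= w x)%R) ->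
  (forall A, measurable A -> measurable_fun setT (fun x => K x A)) ->
  exists nu : {measure set S -> \bar R},
    forall A, nu A = \int[mu]_x ((w x)%:E * K x A).
Proof.
move=> mw w0 mK; apply: measure_of_sigma_additive => [|A|F mF tF mUF].
- by under eq_integral do rewrite measure0 mule0; rewrite integral0.
- by apply: integral_ge0 => x _; rewrite mule_ge0// lee_fin.
- rewrite (_ : \int[mu]_x _ = \sum_(n <oo) \int[mu]_x ((w x)%:E * K x (F n))).
    apply: is_cvg_ereal_nneg_natsum_cond => n _ _.
    by apply: integral_ge0 => x _; rewrite mule_ge0// lee_fin.
  rewrite -integral_nneseries//; last 2 first.
  + by move=> n; apply: emeasurable_funM; [exact/measurable_EFinP|exact: mK].
  + by move=> n x _; rewrite mule_ge0// lee_fin.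
  by apply: eq_integral => x _; rewrite measure_semi_bigcup// nneseriesZl.
Qed.

Import HBNNSimple.

(** The integral is a supremum over simple functions, whose level sets are measurable. This replaces
    the raw set functions of the model by genuine measures inside integrals. *)
Lemma eq_on_measurable_integral (m1 m2 : set T -> \bar R) (f : T -> \bar R) :
  (forall A, measurable A -> m1 A = m2 A) ->
  \int[m1]_x f x = \int[m2]_x f x.
Proof.
move=> m12; rewrite /integral.
have E (g : T -> \bar R) :
    [set sintegral m1 h | h in [set h : {nnsfun T >-> R} | forall x, (h x)%:E <= g x]] =
    [set sintegral m2 h | h in [set h : {nnsfun T >-> R} | forall x, (h x)%:E <= g x]].
  by apply: eq_imagel => h _; apply: eq_fsbigr => r _; rewrite m12.
by rewrite !E.
Qed.

(** From indicators to simple functions by linearity, then to [f] by monotone convergence along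
    [nnsfun_approx]. *)
Lemma integral_density (mu nu : {measure set T -> \bar R}) (g : T -> R) :
  measurable_fun setT g -> (forall x, (0 <= g x)%R) ->
  (forall A, measurable A -> nu A = \int[mu]_(x in A) (g x)%:E) ->
  forall f : T -> \bar R, measurable_fun setT f -> (forall x, 0 <= f x) ->
  \int[nu]_x f x = \int[mu]_x (f x * (g x)%:E).
Proof.
move=> mg g0 nuE f mf f0.
have mgE : measurable_fun setT (EFin \o g) by exact/measurable_EFinP.
pose f_ := nnsfun_approx measurableT mf.
have cf x : (f_ n x)%:E @[n --> \oo] --> f x by exact: cvg_nnsfun_approx.
have ndf x : {homo (fun n => (f_ n x)%:E) : m n / (m <= n)%N >-> m <= n}.
  by move=> m n mn; rewrite lee_fin; exact/lefP/nd_nnsfun_approx.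
transitivity (limn (fun n => \int[nu]_x (f_ n x)%:E)).
  rewrite -monotone_convergence//=.
  - by apply: eq_integral => x _; apply/esym/cvg_lim.
  - by move=> n; exact/measurable_EFinP/measurable_funTS.
  - by move=> n x _; rewrite lee_fin.
transitivity (limn (fun n => \int[mu]_x ((f_ n x)%:E * (g x)%:E))); last first.
  rewrite -monotone_convergence//=.
  - by apply: eq_integral => x _; apply: cvg_lim => //; apply: cvgeZr => //; exact: cf.
  - move=> n; apply: emeasurable_funM => //.
    exact/measurable_EFinP/measurable_funTS.
  - by move=> n x _; rewrite mule_ge0// lee_fin.
  - by move=> x _ m n mn; rewrite lee_wpmul2r// ?lee_fin// -lee_fin; exact: ndf.
apply: congr_lim; apply/funext => n.
have indE A : measurable A ->
    \int[nu]_x (\1_A x)%:E = \int[mu]_x ((\1_A x)%:E * (g x)%:E).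
  move=> mA; rewrite integral_indic// setIT nuE// integral_mkcond.
  apply: eq_integral => x _; rewrite /patch indicE.
  by case: ifPn => _; rewrite ?mul1e ?mul0e.
under eq_integral do rewrite fimfunE -fsumEFin//.
rewrite ge0_integral_fsum//; last 2 first.
  - by move=> r; exact/measurable_EFinP/measurableT_comp.
  - by move=> r x _; rewrite EFinM nnfun_muleindic_ge0.
under [RHS]eq_integral.
  move=> x _; rewrite fimfunE -fsumEFin// ge0_mule_fsuml; last first.
    by move=> r; rewrite EFinM nnfun_muleindic_ge0.
  over.
rewrite [RHS]ge0_integral_fsum//; last 2 first.
  - move=> r; apply: emeasurable_funM => //.
    exact/measurable_EFinP/measurableT_comp.
  - by move=> r x _; apply: mule_ge0; [rewrite EFinM nnfun_muleindic_ge0|rewrite lee_fin].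
apply: eq_fsbigr => r _.
(* The range condition on [r] was dropped; a negative [r] has empty preimage, so both sides
   vanish. *)
have [r0|r0] := leP 0%R r; last first.
  rewrite preimage_nnfun0//.
  by rewrite !integral0_eq// => x _; rewrite indic0 mulr0// mul0e.
under eq_integral do rewrite EFinM.
under [RHS]eq_integral do rewrite EFinM -muleA.
rewrite ge0_integralZl ?lee_fin//; last exact/measurable_EFinP/measurable_indic.
rewrite [RHS]ge0_integralZl ?lee_fin//; last 2 first.
  - by apply: emeasurable_funM => //; exact/measurable_EFinP/measurable_indic.
  - by move=> x _; rewrite mule_ge0// lee_fin.
by rewrite indE.
Qed.
End MeasureGeneralities.

(** * Gaussian kernels *)

Section Gaussian.
Context {R : realType}.
Implicit Types a c s r x y z m : R.
Notation mu := (@lebesgue_measure R).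

Lemma measurable_normal_pdf2 a s : (0 < s)%R ->
  measurable_fun [set: measurableTypeR R * measurableTypeR R]
    (fun p => normal_pdf (a * p.1) s p.2).
Proof.
move=> s0; rewrite (_ : (fun _ => _) = (fun p =>
    normal_peak s * expR (- (p.2 - a * p.1) ^+ 2 / (s ^+ 2 *+ 2)))%R); last first.
  by apply/funext => p; rewrite normal_pdfE ?gt_eqF.
apply: measurable_funM => //; apply: measurableT_comp => //.
apply: measurable_funM => //; apply: measurableT_comp => //.
apply: measurable_funX; apply: measurable_funB => //.
exact: measurable_funM.
Qed.

Lemma normal_prob_indic m s (A : set (measurableTypeR R)) :
  normal_prob m s A = \int[mu]_y (normal_pdf m s y * \1_A y)%:E.
Proof.
rewrite /normal_prob integral_mkcond; apply: eq_integral => y _.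
by rewrite patchE indicE; case: ifPn => _; rewrite ?mulr1 ?mulr0.
Qed.

Lemma measurable_indic_snd (A : set (measurableTypeR R)) : measurable A ->
  measurable_fun [set: measurableTypeR R * measurableTypeR R]
    (fun p => \1_A p.2 : R).
Proof.
move=> mA.
exact: (@measurableT_comp _ _ _ _ _ _ (\1_A : measurableTypeR R -> R) _ snd).
Qed.

Lemma measurable_normal_prob a s (A : set (measurableTypeR R)) :
  (0 < s)%R -> measurable A ->
  measurable_fun [set: measurableTypeR R] (fun x => normal_prob (a * x) s A).
Proof.
move=> s0 mA.
pose f (p : measurableTypeR R * measurableTypeR R) : \bar R :=
  (normal_pdf (a * p.1) s p.2 * \1_A p.2)%:E.
apply: (eq_measurable_fun (fun x => \int[mu]_y f (x, y))) => [x _|].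
  by rewrite normal_prob_indic.
apply: (measurable_fun_fubini_tonelli_F (m2 := mu) f) => [|p].
  apply/measurable_EFinP; apply: measurable_funM.
    exact: measurable_normal_pdf2.
  exact: measurable_indic_snd.
by rewrite /f lee_fin mulr_ge0// normal_pdf_ge0.
Qed.

(** Completing the square in [x]: the precision [1 / sigma ^+ 2] becomes
    [1 / sigma ^+ 2 + c = 1 / s ^+ 2], and what remains is a Gaussian tilt in [z]. *)
Lemma normal_pdf_potential rho sigma c z x :
  (0 < sigma)%R -> (0 < c)%R ->
  let h := (1 + sigma ^+ 2 * c)%R in
  let s := Num.sqrt (sigma ^+ 2 / h) in
  (normal_pdf (rho * z) sigma x * expR (- (c * x ^+ 2 / 2)) =
   normal_peak sigma / normal_peak s * expR (- (rho ^+ 2 * c / h * z ^+ 2 / 2)) *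
   normal_pdf (rho / h * z) s x)%R.
Proof.
move=> s0 c0 h s.
have h0 : (0 < h)%R by rewrite addr_gt0// mulr_gt0// exprn_gt0.
have ss : (s ^+ 2 = sigma ^+ 2 / h)%R.
  by rewrite sqr_sqrtr// divr_ge0// ltW// exprn_gt0.
have sgt0 : (0 < s)%R by rewrite sqrtr_gt0 divr_gt0// exprn_gt0.
have p0 : (normal_peak s != 0)%R by rewrite gt_eqF// normal_peak_gt0// gt_eqF.
rewrite !normal_pdfE ?gt_eqF// /normal_fun -!mulrA.
rewrite [in RHS](mulrCA (expR _)) -expRD.
rewrite mulKf// -expRD; congr (_ * expR _)%R.
rewrite ss /h; field.
by rewrite !gt_eqF.
Qed.

(** Completing the square in [x], then in [y]. The product has precision [1 / sigma ^+ 2 + g + a ^+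
    2 / s ^+ 2 = 1 / r ^+ 2] in [x], and the variance left for [y] is [s' ^+ 2 = s ^+ 2 + a ^+ 2 *
    sigma ^+ 2 / h]. *)
Lemma normal_pdf_chain rho sigma g a s z x y :
  (0 < sigma)%R -> (0 < g)%R -> (0 < s)%R ->
  let h := (1 + sigma ^+ 2 * g)%R in
  let q := (s ^+ 2 * h + a ^+ 2 * sigma ^+ 2)%R in
  let s' := Num.sqrt (q / h) in
  let r := Num.sqrt (sigma ^+ 2 * s ^+ 2 / q) in
  (normal_pdf (rho * z) sigma x * expR (- (g * x ^+ 2 / 2)) *
   normal_pdf (a * x) s y =
   (normal_peak sigma * normal_peak s / (normal_peak s' * normal_peak r) *
    expR (- (rho ^+ 2 * g / h * z ^+ 2 / 2))) *
   normal_pdf (rho * a / h * z) s' y *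
   normal_pdf ((rho * z * s ^+ 2 + a * y * sigma ^+ 2) / q) r x)%R.
Proof.
move=> sigma0 g0 s0 h q s' r.
have h0 : (0 < h)%R by rewrite addr_gt0// mulr_gt0// exprn_gt0.
have q0 : (0 < q)%R.
  by rewrite /q ltr_wpDr//; [rewrite mulr_ge0 ?sqr_ge0|rewrite mulr_gt0 ?exprn_gt0].
have s's : (s' ^+ 2 = q / h)%R by rewrite sqr_sqrtr// divr_ge0// ltW.
have s'0 : (0 < s')%R by rewrite sqrtr_gt0 divr_gt0.
have rr : (r ^+ 2 = sigma ^+ 2 * s ^+ 2 / q)%R.
  by rewrite sqr_sqrtr// divr_ge0// ?mulr_ge0 ?sqr_ge0// ltW.
have r0 : (0 < r)%R by rewrite sqrtr_gt0 divr_gt0// mulr_gt0// exprn_gt0.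
have peakN0 t : (0 < t)%R -> (normal_peak t != 0)%R.
  by move=> t0; rewrite gt_eqF// normal_peak_gt0// gt_eqF.
rewrite !normal_pdfE ?gt_eqF// /normal_fun.
set e1 := expR _; set e2 := expR _; set e3 := expR _.
set e4 := expR _; set e5 := expR _; set e6 := expR _.
have -> : (normal_peak sigma * e1 * e2 * (normal_peak s * e3) =
  normal_peak sigma * normal_peak s * (e1 * e2 * e3))%R by ring.
have -> : (normal_peak sigma * normal_peak s / (normal_peak s' * normal_peak r) *
  e4 * (normal_peak s' * e5) * (normal_peak r * e6) =
  normal_peak sigma * normal_peak s * (e4 * e5 * e6))%R.
  by field; rewrite !peakN0.
rewrite /e1 /e2 /e3 /e4 /e5 /e6 -!expRD; congr (_ * expR _)%R.
rewrite s's rr /q /h; field.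
by rewrite exprMn -/h -/q !gt_eqF.
Qed.

(** By Tonelli [x] is integrated first; the factor isolated by [normal_pdf_chain] is a probability
    density in [x] and contributes 1. *)
Lemma normal_chain rho sigma g a s z (A : set (measurableTypeR R)) :
  (0 < sigma)%R -> (0 < g)%R -> (0 < s)%R -> measurable A ->
  let h := (1 + sigma ^+ 2 * g)%R in
  let q := (s ^+ 2 * h + a ^+ 2 * sigma ^+ 2)%R in
  let s' := Num.sqrt (q / h) in
  let r := Num.sqrt (sigma ^+ 2 * s ^+ 2 / q) in
  \int[mu]_x ((normal_pdf (rho * z) sigma x * expR (- (g * x ^+ 2 / 2)))%:E *
    normal_prob (a * x) s A) =
  (normal_peak sigma * normal_peak s / (normal_peak s' * normal_peak r) *
    expR (- (rho ^+ 2 * g / h * z ^+ 2 / 2)))%:E *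
  normal_prob (rho * a / h * z) s' A.
Proof.
move=> sigma0 g0 s0 mA h q s' r.
set W := (X in X%:E * _).
have W0 : (0 <= W)%R.
  by rewrite mulr_ge0 ?expR_ge0// divr_ge0 ?mulr_ge0 ?normal_peak_ge0.
pose e x := (normal_pdf (rho * z) sigma x * expR (- (g * x ^+ 2 / 2)))%R.
have e0 x : (0 <= e x)%R by rewrite mulr_ge0 ?normal_pdf_ge0 ?expR_ge0.
have me : measurable_fun setT e.
  apply: measurable_funM; first exact: measurable_normal_pdf.
  do 2 apply: measurableT_comp => //; apply: measurable_funM => //.
  by apply: measurable_funM => //; exact: measurable_funX.
have m_pdf m t : measurable_fun setT (fun y : measurableTypeR R => normal_pdf m t y * \1_A y)%R.
  apply: measurable_funM; first exact: measurable_normal_pdf.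
  exact: measurable_indic.
pose f (p : measurableTypeR R * measurableTypeR R) : \bar R :=
  (e p.1 * (normal_pdf (a * p.1) s p.2 * \1_A p.2))%:E.
transitivity (\int[mu]_x \int[mu]_y f (x, y)).
  apply: eq_integral => x _; rewrite normal_prob_indic -ge0_integralZl ?lee_fin//.
  - exact/measurable_EFinP.
  - by move=> y _; rewrite lee_fin mulr_ge0 ?normal_pdf_ge0.
  - exact: e0.
rewrite (fubini_tonelli f); last 2 first.
- apply/measurable_EFinP; apply: measurable_funM.
    exact: (@measurableT_comp _ _ _ _ _ _ e _ fst).
  apply: measurable_funM; first exact: measurable_normal_pdf2.
  exact: measurable_indic_snd.
- by move=> p; rewrite lee_fin mulr_ge0 ?e0// mulr_ge0 ?normal_pdf_ge0.
rewrite normal_prob_indic -ge0_integralZl//; last 2 first.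
- exact/measurable_EFinP.
- by move=> y _; rewrite lee_fin mulr_ge0 ?normal_pdf_ge0.
apply: eq_integral => y _.
pose l := ((rho * z * s ^+ 2 + a * y * sigma ^+ 2) / q)%R.
transitivity (\int[mu]_x ((W * normal_pdf (rho * a / h * z) s' y * \1_A y)%:E *
    (normal_pdf l r x)%:E)).
  apply: eq_integral => x _; rewrite /f/= -EFinM; congr EFin.
  by rewrite mulrA /e normal_pdf_chain// mulrAC.
rewrite ge0_integralZl//; last 3 first.
- by apply/measurable_EFinP; exact: measurable_normal_pdf.
- by move=> x _; rewrite lee_fin normal_pdf_ge0.
- by rewrite lee_fin mulr_ge0 ?indicE// (mulr_ge0 W0)// normal_pdf_ge0.
by rewrite integral_normal_pdf mule1 -EFinM mulrA.
Qed.
End Gaussian.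

(** * Tightness of normal distributions *)

Section LineProbabilities.
Context {R : realType}.
Implicit Types (a b c s r x y z m : R).

Lemma normalized_measure d (T : measurableType d)
    (nu : {measure set T -> \bar R}) (Z : R) : nu setT = Z%:E -> (0 < Z)%R ->
  exists F : probability T R, forall A, F A = nu A * (Z^-1%R)%:E.
Proof.
move=> nuZ Z0.
have E (P : probability T R) A : mnormalize nu P A = nu A * (Z^-1%R)%:E.
  by rewrite /mnormalize nuZ ifF//; apply/negbTE; rewrite negb_or gt_eqF ?lte_fin.
(* [dirac point] is the default of [mnormalize] for total mass 0 or infinity, excluded by
   [0 < Z]. *)
by exists (mnormalize nu (dirac point)) => A; rewrite -(E (dirac point)).
Qed.

Lemma probability_tight (P : probability (measurableTypeR R) R) (e : R) :
  (0 < e)%R -> exists2 K : R, (0 < K)%R & (1 - e)%:E <= P `[(- K)%R, K]%classic.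
Proof.
move=> e0.
pose I n : set (measurableTypeR R) := `[(- n%:R)%R, n%:R]%classic.
have subI (n k : nat) : (n <= k)%N -> I n `<=` I k.
  rewrite -(ler_nat R) => nm x; rewrite /I/= !in_itv/= => /andP[h1 h2].
  by apply/andP; split; lra.
have cvI : P (I n) @[n --> \oo] --> P (\bigcup_n I n).
  apply: nondecreasing_cvg_mu => //.
  - by move=> n; exact: measurable_itv.
  - by apply: bigcup_measurable => n _; exact: measurable_itv.
  - by move=> n k nk; apply/subsetPset; exact: subI.
have UI : \bigcup_n I n = setT.
  rewrite -subTset => x _.
  exists (Num.truncn `|x|).+1 => //; rewrite /I/= in_itv/= -ler_norml.
  by apply/ltW; exact: truncnS_gt.
rewrite UI probability_setT in cvI.
have [n _ /(_ n (leqnn n)) /= Pn] : \forall n \near \oo, (1 - e)%:E <= P (I n).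
  apply: lte_lim.
  - move=> n k nk; apply: le_measure; rewrite ?inE; [exact: measurable_itv..|].
    exact: subI.
  - by apply/cvg_ex; exists 1.
  - by rewrite (cvg_lim _ cvI)// lte_fin; lra.
exists n.+1%:R => //; apply: le_trans Pn _.
by apply: le_measure; rewrite ?inE; [exact: measurable_itv..|exact: subI].
Qed.

(** Off the interval the density is at most [k] times the normal density of standard deviation
    [2 * s], which has total mass 1. This replaces Chebyshev's inequality and the computation of a
    variance. *)
Lemma normal_tail m s r : (0 < s)%R -> (0 < r)%R ->
  normal_prob m s (~` `[(m - r)%R, (m + r)%R]%classic) <= (6 * s ^+ 2 / r ^+ 2)%:E.
Proof.
move=> s0 r0.
have s2 : (0 < 2 * s)%R by rewrite mulr_gt0.
have peak2 : (normal_peak s = 2 * normal_peak (2 * s))%R.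
  rewrite /normal_peak exprMn (_ : 2 ^+ 2 * _ * _ *+ 2 = 2 ^+ 2 * (s ^+ 2 * pi *+ 2))%R; last ring.
  rewrite sqrtrM ?sqr_ge0// sqrtr_sqr ger0_norm// invfM mulVKf//.
set A := ~` _.
have mA : measurable (A : set (measurableTypeR R)) by apply: measurableC; exact: measurable_itv.
pose k := (2 * expR (- (3 * r ^+ 2 / (8 * s ^+ 2))))%R.
apply: (@le_trans _ _ (\int[lebesgue_measure]_(y in A) (k * normal_pdf m (2 * s) y)%:E)).
  apply: ge0_le_integral => //=.
  - by move=> y _; rewrite lee_fin normal_pdf_ge0.
  - by apply/measurable_EFinP/measurable_funTS; exact: measurable_normal_pdf.
  - apply/measurable_EFinP/measurable_funTS; apply: measurable_funM => //.
    exact: measurable_normal_pdf.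
  - move=> y Ay; rewrite lee_fin !normal_pdfE ?gt_eqF// peak2 /k.
    rewrite -!mulrA ler_pM2l// [leRHS]mulrCA ler_pM2l ?normal_peak_gt0 ?gt_eqF//.
    rewrite /normal_fun -expRD ler_expR.
    have ry : (r ^+ 2 <= (y - m) ^+ 2)%R.
      rewrite -[leRHS]real_normK ?num_real// ler_pXn2r ?nnegrE ?normr_ge0 ?(ltW r0)//.
      move: Ay; rewrite /A/= in_itv/= => /negP; rewrite negb_and -!ltNge => /orP[] h.
        by rewrite ler_normr; apply/orP; right; lra.
      by rewrite ler_normr; apply/orP; left; lra.
    rewrite -subr_ge0.
    rewrite (_ : _ - _ = (3 * ((y - m) ^+ 2 - r ^+ 2)) / (8 * s ^+ 2))%R; last first.
      by field; rewrite gt_eqF.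
    by rewrite divr_ge0// mulr_ge0 ?sqr_ge0 ?subr_ge0.
apply: (@le_trans _ _ (\int[lebesgue_measure]_y (k * normal_pdf m (2 * s) y)%:E)).
  apply: ge0_subset_integral => //.
  - apply/measurable_EFinP; apply: measurable_funM => //; exact: measurable_normal_pdf.
  - by move=> y _; rewrite lee_fin mulr_ge0 ?normal_pdf_ge0// mulr_ge0 ?expR_ge0.
under eq_integral do rewrite EFinM.
rewrite ge0_integralZl//; last 3 first.
- by apply/measurable_EFinP; exact: measurable_normal_pdf.
- by move=> x _; rewrite lee_fin normal_pdf_ge0.
- by rewrite lee_fin mulr_ge0 ?expR_ge0.
rewrite integral_normal_pdf mule1 lee_fin /k.
set u := (3 * r ^+ 2 / (8 * s ^+ 2))%R.
have u0 : (0 < u)%R by rewrite divr_gt0 ?mulr_gt0 ?exprn_gt0.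
(* From [expR u >= 1 + u]. The resulting constant is 16/3, rounded up to 6. *)
have : (expR (- u) <= u^-1)%R.
  by rewrite expRN lef_pV2 ?posrE ?expR_gt0//; have := expR_ge1Dx u; lra.
have -> : (u^-1 = 8 / 3 * (s ^+ 2 / r ^+ 2))%R by rewrite /u; field; rewrite !gt_eqF.
have : (0 <= s ^+ 2 / r ^+ 2)%R by rewrite divr_ge0 ?sqr_ge0.
by rewrite -(mulrA 6%R); lra.
Qed.

Lemma normal_core (M S e : R) : (0 <= M)%R -> (0 < S)%R -> (0 < e)%R ->
  exists2 B : R, (0 < B)%R & forall m s, (`|m| <= M)%R -> (0 < s)%R -> (s ^+ 2 <= S)%R ->
    (1 - e)%:E <= normal_prob m s `[(- B)%R, B]%classic.
Proof.
(* With this [r] the bound of [normal_tail] is at most [e] as soon as [s ^+ 2 <= S]. *)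
move=> M0 S0 e0; pose r := Num.sqrt (6 * S / e).
have rr : (r ^+ 2 = 6 * S / e)%R by rewrite sqr_sqrtr// divr_ge0 ?mulr_ge0 ?ltW.
have r0 : (0 < r)%R by rewrite sqrtr_gt0 divr_gt0// mulr_gt0.
exists (M + r)%R; first lra.
move=> m s mM s0 sS.
pose I : set (measurableTypeR R) := `[(m - r)%R, (m + r)%R]%classic.
have mI : measurable I by exact: measurable_itv.
apply: (@le_trans _ _ (normal_prob m s I)); last first.
  apply: le_measure; rewrite ?inE; [exact: measurable_itv..|].
  move=> y; rewrite /I/= !in_itv/= => /andP[h1 h2].
  by move: mM; rewrite ler_norml => /andP[h3 h4]; apply/andP; split; lra.
have := normal_tail m s0 r0.
rewrite probability_setC// leeBlDr ?fin_num_measure// => h.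
rewrite EFinB leeBlDr//; apply: le_trans h _; rewrite addeC leeD2l// lee_fin rr.
rewrite (_ : _ / _ = e * (s ^+ 2 / S))%R; last by field; rewrite !gt_eqF.
by rewrite ler_piMr ?(ltW e0)// ler_pdivrMr// mul1r.
Qed.
End LineProbabilities.

(** * Iterates of the Feynman-Kac kernel *)

Section Model.
Context {R : realType}.
Variables (rho sigma c : R).
Hypotheses (sigma_gt0 : (0 < sigma)%R) (c_gt0 : (0 < c)%R).
Implicit Types (a b s x z : R) (A : set (measurableTypeR R)).
Notation mu := (@lebesgue_measure R).

Lemma Gpot_gt0 x : (0 < Gpot c x)%R. Proof. exact: expR_gt0. Qed.

Lemma measurable_tilt b :
  measurable_fun [set: measurableTypeR R] (fun x : R => expR (- (b * x ^+ 2 / 2)))%R.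
Proof.
do 2 apply: measurableT_comp => //; apply: measurable_funM => //.
by apply: measurable_funM => //; exact: measurable_funX.
Qed.

Lemma Qker_density z A : measurable A ->
  Qker rho sigma c z A =
  \int[mu]_(x in A) (normal_pdf (rho * z) sigma x * Gpot c x)%:E.
Proof.
move=> mA; rewrite /Qker integral_mkcond.
rewrite (@integral_density _ _ _ mu (normal_prob (rho * z) sigma) (normal_pdf (rho * z) sigma)).
- rewrite [RHS]integral_mkcond; apply: eq_integral => x _; rewrite /patch.
  by case: ifPn => _; rewrite ?mul0e// -EFinM mulrC.
- exact: measurable_normal_pdf.
- by move=> x; exact: normal_pdf_ge0.
- by [].
- apply/(measurable_restrictT _ mA)/measurable_EFinP/measurable_funTS.
  exact: measurable_tilt.
- by move=> x; rewrite /patch; case: ifPn => // _; rewrite lee_fin ltW ?Gpot_gt0.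
Qed.

Lemma integral_Qker z (f : measurableTypeR R -> \bar R) :
  measurable_fun setT f -> (forall x, 0 <= f x) ->
  \int[(Qker rho sigma c z : set (measurableTypeR R) -> \bar R)]_x f x =
  \int[mu]_x (f x * (normal_pdf (rho * z) sigma x * Gpot c x)%:E).
Proof.
move=> mf f0.
have mg : measurable_fun [set: measurableTypeR R]
    (fun x => normal_pdf (rho * z) sigma x * Gpot c x)%R.
  by apply: measurable_funM; [exact: measurable_normal_pdf|exact: measurable_tilt].
have g0 x : (0 <= normal_pdf (rho * z) sigma x * Gpot c x)%R.
  by rewrite mulr_ge0 ?normal_pdf_ge0// ltW ?Gpot_gt0.
have [nu nuE] := density_measure mu mg g0.
transitivity (\int[nu]_x f x).
  by apply: eq_on_measurable_integral => A mA; rewrite nuE Qker_density.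
by apply: (integral_density mg g0) => // A mA; rewrite nuE.
Qed.

Lemma Qker_gaussian : let h := (1 + sigma ^+ 2 * c)%R in
  let s := Num.sqrt (sigma ^+ 2 / h) in
  forall z A, measurable A -> Qker rho sigma c z A =
    (normal_peak sigma / normal_peak s *
       expR (- (rho ^+ 2 * c / h * z ^+ 2 / 2)))%:E *
    normal_prob (rho / h * z) s A.
Proof.
move=> h s z A mA; rewrite Qker_density//.
under eq_integral do rewrite normal_pdf_potential// EFinM.
rewrite ge0_integralZl//.
- by apply/measurable_EFinP/measurable_funTS; exact: measurable_normal_pdf.
- by move=> x _; rewrite lee_fin normal_pdf_ge0.
- by rewrite lee_fin mulr_ge0 ?expR_ge0// divr_ge0 ?normal_peak_ge0.
Qed.

(* The quantity [s ^+ 2 + a ^+ 2 / (c + b)] does not increase along the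
   Riccati-type recursion satisfied by the parameters of the iterates. *)
Lemma Qpow_gaussian k : exists W b a s : R,
  [/\ (0 < W)%R, (0 <= b)%R & (0 < s)%R] /\
  [/\ (s ^+ 2 + a ^+ 2 / (c + b) <= c^-1)%R, (b <= rho ^+ 2 / sigma ^+ 2)%R &
  forall z A, measurable A -> Qpow rho sigma c k z A =
    (W * expR (- (b * z ^+ 2 / 2)))%:E * normal_prob (a * z) s A].
Proof.
have s2 : (0 < sigma ^+ 2)%R by rewrite exprn_gt0.
have s2N0 : (sigma ^+ 2 != 0)%R by rewrite gt_eqF.
have peak0 t : (0 < t)%R -> (0 < normal_peak t)%R.
  by move=> t0; rewrite normal_peak_gt0 ?gt_eqF.
have divS_ge0 (x y z : R) : (0 <= y -> 0 <= z -> 0 <= x ^+ 2 * y / z)%R.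
  by move=> y0 z0; rewrite divr_ge0// mulr_ge0// sqr_ge0.
elim: k => [|k [W [b [a [s [[W0 b0 s0] [inv bb QE]]]]]]].
  pose h := (1 + sigma ^+ 2 * c)%R.
  pose s := Num.sqrt (sigma ^+ 2 / h).
  have h0 : (0 < h)%R by rewrite addr_gt0// mulr_gt0.
  have s0 : (0 < s)%R by rewrite sqrtr_gt0 divr_gt0.
  exists (normal_peak sigma / normal_peak s)%R, (rho ^+ 2 * c / h)%R, (rho / h)%R, s.
  split; split=> //.
  - by rewrite divr_gt0 ?peak0.
  - exact: divS_ge0 (ltW c_gt0) (ltW h0).
  - rewrite sqr_sqrtr; last by rewrite divr_ge0// ltW.
    have k0 : (0 < h + rho ^+ 2)%R by rewrite ltr_pwDl// sqr_ge0.
    (* The exact slack in the invariant for the first power, visibly nonnegative. *)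
    rewrite -subr_ge0 (_ : _ - _ = (c * (h + rho ^+ 2))^-1)%R.
      by rewrite invr_ge0 mulr_ge0// ltW.
    rewrite /h; field; rewrite -/h !gt_eqF//=.
    by rewrite (_ : _ + _ = c * (h + rho ^+ 2))%R ?mulr_gt0// /h; ring.
  - rewrite -subr_ge0 (_ : _ - _ = rho ^+ 2 / (sigma ^+ 2 * h))%R.
      by rewrite divr_ge0 ?sqr_ge0// mulr_ge0// ltW.
    by rewrite /h; field; rewrite -/h !gt_eqF.
  - exact: Qker_gaussian.
(* The tilt of the previous iterate and the potential [Gpot c] merge into a single Gaussian
   potential of parameter [g], which puts the step in the form of [normal_chain]. *)
pose g := (c + b)%R.
have g0 : (0 < g)%R by rewrite ltr_pwDl.
pose h := (1 + sigma ^+ 2 * g)%R.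
pose q := (s ^+ 2 * h + a ^+ 2 * sigma ^+ 2)%R.
pose s' := Num.sqrt (q / h).
pose r := Num.sqrt (sigma ^+ 2 * s ^+ 2 / q).
have h0 : (0 < h)%R by rewrite addr_gt0// mulr_gt0.
have q0 : (0 < q)%R.
  by rewrite /q ltr_wpDr//; [rewrite mulr_ge0 ?sqr_ge0|rewrite mulr_gt0 ?exprn_gt0].
have s'0 : (0 < s')%R by rewrite sqrtr_gt0 divr_gt0.
have r0 : (0 < r)%R by rewrite sqrtr_gt0 divr_gt0// mulr_gt0// exprn_gt0.
exists (W * (normal_peak sigma * normal_peak s / (normal_peak s' * normal_peak r)))%R.
exists (rho ^+ 2 * g / h)%R, (rho * a / h)%R, s'.
split; split=> //.
- by rewrite mulr_gt0// divr_gt0 ?mulr_gt0 ?peak0.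
- exact: divS_ge0 (ltW g0) (ltW h0).
- apply: le_trans inv; rewrite sqr_sqrtr; last by rewrite divr_ge0// ltW.
  have k0 : (0 < c * h + rho ^+ 2 * g)%R.
    by rewrite ltr_wpDr ?mulr_gt0// mulr_ge0 ?sqr_ge0// ltW.
  rewrite -/g -subr_ge0.
  (* The exact decrease of the invariant in one step. *)
  rewrite (_ : _ - _ = a ^+ 2 * c / (g * (c * h + rho ^+ 2 * g)))%R.
    by apply: divS_ge0; rewrite ltW// mulr_gt0.
  by rewrite /q /h; field; rewrite -/h !gt_eqF.
(* Since [h - sigma ^+ 2 * g = 1], the new tilt [rho ^+ 2 * g / h] is bounded whatever the size of
   [g]. *)
- rewrite -subr_ge0 (_ : _ - _ = rho ^+ 2 / (sigma ^+ 2 * h))%R.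
    by rewrite divr_ge0 ?sqr_ge0// mulr_ge0// ltW.
  by rewrite /h; field; rewrite -/h !gt_eqF.
- move=> z A mA; have mt := measurable_tilt b.
  transitivity (\int[(Qker rho sigma c z : set (measurableTypeR R) -> \bar R)]_x
      ((W * expR (- (b * x ^+ 2 / 2)))%:E * normal_prob (a * x) s A)).
    by rewrite /= /apply_kernel; congr integral; apply/funext => x; rewrite QE.
  rewrite integral_Qker; last 2 first.
  + apply: emeasurable_funM; last exact: measurable_normal_prob.
    by apply/measurable_EFinP; apply: measurable_funM.
  + by move=> x; rewrite mule_ge0// lee_fin mulr_ge0 ?expR_ge0// ltW.
  have gE x : (expR (- (b * x ^+ 2 / 2)) * Gpot c x)%R = expR (- (g * x ^+ 2 / 2))%R.
    by rewrite -expRD /g; congr expR; ring.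
  transitivity (\int[mu]_x (W%:E * ((normal_pdf (rho * z) sigma x *
      expR (- (g * x ^+ 2 / 2)))%:E * normal_prob (a * x) s A))).
    apply: eq_integral => x _; rewrite -gE muleAC -EFinM muleA -EFinM.
    by congr (_%:E * _); ring.
  rewrite ge0_integralZl//; last 3 first.
  + apply: emeasurable_funM; last exact: measurable_normal_prob.
    apply/measurable_EFinP; apply: measurable_funM; last exact: measurable_tilt.
    exact: measurable_normal_pdf.
  + by move=> x _; rewrite mule_ge0// lee_fin mulr_ge0 ?expR_ge0 ?normal_pdf_ge0.
  + by rewrite lee_fin ltW.
  by rewrite normal_chain// muleA -EFinM mulrA.
Qed.
End Model.

(** * Tilted Gaussian mixtures *)

Section Filters.
Context {R : realType}.
Variables (c : R) (c_gt0 : (0 < c)%R).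
Variable eta1 : probability (measurableTypeR R) R.
Implicit Types (a b s x z : R) (A : set (measurableTypeR R)).

Lemma le_tilt b (K x : R) : (0 <= b)%R -> (0 <= K)%R ->
  (`|x| <= K)%R -> (expR (- (b * K ^+ 2 / 2)) <= expR (- (b * x ^+ 2 / 2)))%R.
Proof.
move=> b0 K0 xK; rewrite ler_expR lerN2 ler_pM2r ?invr_gt0// ler_wpM2l//.
by rewrite -(real_normK (num_real x)) ler_pXn2r ?nnegrE.
Qed.

Lemma ge_tilt b (K x : R) : (0 <= b)%R -> (0 <= K)%R ->
  (K <= `|x|)%R -> (expR (- (b * x ^+ 2 / 2)) <= expR (- (b * K ^+ 2 / 2)))%R.
Proof.
move=> b0 K0 xK; rewrite ler_expR lerN2 ler_pM2r ?invr_gt0// ler_wpM2l//.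
by rewrite -(real_normK (num_real x)) ler_pXn2r ?nnegrE.
Qed.

Lemma tilt_le1 b x : (0 <= b)%R -> (expR (- (b * x ^+ 2 / 2)) <= 1)%R.
Proof.
move=> b0; rewrite -[leRHS]expR0 ler_expR oppr_le0.
by rewrite divr_ge0// mulr_ge0// sqr_ge0.
Qed.

Lemma ge_integral_tilt (P : probability (measurableTypeR R) R) b (K : R) :
  (0 <= b)%R -> (0 <= K)%R ->
  (expR (- (b * K ^+ 2 / 2)))%:E * P `[(- K)%R, K]%classic <=
  \int[P]_(x in `[(- K)%R, K]%classic) (expR (- (b * x ^+ 2 / 2)))%:E.
Proof.
move=> b0 K0; have mI : measurable (`[(- K)%R, K]%classic : set (measurableTypeR R)).
  exact: measurable_itv.
rewrite -integral_cst//; apply: ge0_le_integral => //.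
- by move=> x _; rewrite lee_fin expR_ge0.
- by apply/measurable_EFinP/measurable_funTS; exact: measurable_tilt.
- move=> x; rewrite /= in_itv/= -ler_norml => xK.
  by rewrite lee_fin le_tilt.
Qed.

(** Finite because the tilt is at most 1; positive because some compact interval carries half of the
    mass and the tilt is bounded below there. This legitimates all normalisations. *)
Lemma integral_tilt (P : probability (measurableTypeR R) R) b : (0 <= b)%R ->
  exists2 T : R, (0 < T)%R & \int[P]_x (expR (- (b * x ^+ 2 / 2)))%:E = T%:E.
Proof.
move=> b0; pose J := \int[P]_x (expR (- (b * x ^+ 2 / 2)))%:E.
have mt := measurable_tilt b.
have J1 : J <= 1.
  rewrite -[leRHS](probability_setT P) -[leRHS]mul1e -integral_cst//.
  apply: ge0_le_integral => //.
  - exact/measurable_EFinP.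
  - by move=> x _; rewrite lee_fin tilt_le1.
have half0 : (0 < 2^-1 :> R)%R by rewrite invr_gt0.
have [K K0 PK] := probability_tight P half0.
have J0 : 0 < J.
  apply: (@lt_le_trans _ _ (\int[P]_(x in `[(- K)%R, K]%classic)
      (expR (- (b * x ^+ 2 / 2)))%:E)); last first.
    apply: ge0_subset_integral => //.
    - exact/measurable_EFinP.
  apply: lt_le_trans (ge_integral_tilt P b0 (ltW K0)).
  rewrite mule_gt0 ?lte_fin ?expR_gt0//; apply: lt_le_trans PK.
  by rewrite lte_fin; lra.
exists (fine J); first by rewrite fine_gt0// J0/= (le_lt_trans J1)// ltry.
by rewrite fineK// ge0_fin_numE ?(ltW J0)// (le_lt_trans J1)// ltry.
Qed.

Lemma filter1_probability : exists F : probability (measurableTypeR R) R,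
  forall A, measurable A -> filter1 c eta1 A = F A.
Proof.
have [Z Z0 ZE] := integral_tilt eta1 (ltW c_gt0).
have [nu nuE] := density_measure eta1 (measurable_tilt c) (fun x => ltW (Gpot_gt0 c x)).
have nuZ : nu setT = Z%:E by rewrite nuE.
have [F FE] := normalized_measure nuZ Z0.
by exists F => A mA; rewrite FE nuE /filter1 ZE inver gt_eqF.
Qed.

(* Tilting by a decreasing function of [`|x|] can only increase the mass of
   [-K, K], so the bound is uniform in [b]. *)
Lemma tilted_mixture_tight (F : probability (measurableTypeR R) R) (M S e : R) :
  (0 <= M)%R -> (0 < S)%R -> (0 < e < 1)%R ->
  exists2 B : R, (0 < B)%R & forall b a s, (0 <= b)%R -> (`|a| <= M)%R ->
    (0 < s)%R -> (s ^+ 2 <= S)%R ->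
    ((1 - e) ^+ 2)%:E * \int[F]_x (expR (- (b * x ^+ 2 / 2)))%:E <=
    \int[F]_x ((expR (- (b * x ^+ 2 / 2)))%:E *
      normal_prob (a * x) s `[(- B)%R, B]%classic).
Proof.
move=> M0 S0 /andP[e0 e1].
have [K K0 FK] := probability_tight F e0.
(* For [x] in [-K, K] the mean [a * x] is at most [M * K] in absolute value, so one [B] serves all
   these components. *)
have [B B0 NB] := normal_core (mulr_ge0 M0 (ltW K0)) S0 e0.
exists B => // b a s b0 aM s0 sS.
pose E x := expR (- (b * x ^+ 2 / 2)).
have mE : measurable_fun [set: measurableTypeR R] E by exact: measurable_tilt.
pose I : set (measurableTypeR R) := `[(- K)%R, K]%classic.
have mI : measurable I by exact: measurable_itv.
have [T T0 TE] := integral_tilt F b0.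
have E0 x : (0 <= E x)%R by exact: expR_ge0.
have split_T : \int[F]_x (E x)%:E =
    \int[F]_(x in I) (E x)%:E + \int[F]_(x in ~` I) (E x)%:E.
  rewrite -ge0_integral_setU//.
  - by rewrite setUv.
  - exact: measurableC.
  - by rewrite setUv; exact/measurable_EFinP.
  - by move=> x _; rewrite lee_fin.
  - by rewrite disj_set2E setICr.
have finI : \int[F]_(x in I) (E x)%:E \is a fin_num.
  rewrite ge0_fin_numE; last by apply: integral_ge0 => x _; rewrite lee_fin.
  apply: le_lt_trans (ltry T); rewrite -TE; apply: ge0_subset_integral => //.
    exact/measurable_EFinP.
  by move=> x _; rewrite lee_fin.
have finIc : \int[F]_(x in ~` I) (E x)%:E \is a fin_num.
  rewrite ge0_fin_numE; last by apply: integral_ge0 => x _; rewrite lee_fin.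
  apply: le_lt_trans (ltry T); rewrite -TE; apply: ge0_subset_integral => //.
  - exact: measurableC.
  - exact/measurable_EFinP.
  - by move=> x _; rewrite lee_fin.
(* The value of the tilt at the boundary of [I] separates its values inside from those outside; it
   cancels in the final comparison, hence the uniformity in [b]. *)
pose eK := expR (- (b * K ^+ 2 / 2)).
have Tin : (eK * (1 - e))%:E <= \int[F]_(x in I) (E x)%:E.
  apply: le_trans (ge_integral_tilt F b0 (ltW K0)).
  by rewrite EFinM lee_pmul2l// lte_fin expR_gt0.
have Tout : \int[F]_(x in ~` I) (E x)%:E <= (eK * e)%:E.
  apply: (@le_trans _ _ (eK%:E * F (~` I))).
    rewrite -integral_cst//; last exact: measurableC.
    apply: ge0_le_integral => //; first exact: measurableC.
    - by move=> x _; rewrite lee_fin.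
    - by apply/measurable_EFinP/measurable_funTS.
    - move=> x; rewrite /I/= in_itv/= -ler_norml => /negP; rewrite -ltNge => xK.
      by rewrite lee_fin ge_tilt ?(ltW K0) ?(ltW xK).
  rewrite EFinM lee_pmul2l ?lte_fin ?expR_gt0//.
  rewrite probability_setC// leeBlDr ?fin_num_measure//.
  by rewrite addeC -leeBlDr// -EFinB.
rewrite split_T.
apply: (@le_trans _ _ ((1 - e)%:E * \int[F]_(x in I) (E x)%:E)); last first.
  rewrite -ge0_integralZl//; last 3 first.
  - by apply/measurable_EFinP/measurable_funTS.
  - by move=> x _; rewrite lee_fin.
  - by rewrite lee_fin; lra.
  apply: (@le_trans _ _ (\int[F]_(x in I)
      ((E x)%:E * normal_prob (a * x) s `[(- B)%R, B]%classic))).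
    apply: ge0_le_integral => //.
    - by move=> x _; rewrite mule_ge0// lee_fin//; lra.
    - apply/measurable_EFinP/measurable_funTS; exact: measurable_funM.
    - apply: emeasurable_funM; first exact/measurable_EFinP/measurable_funTS.
      by apply: measurable_funTS; apply: measurable_normal_prob => //; exact: measurable_itv.
    - move=> x; rewrite /I/= in_itv/= -ler_norml => xK.
      rewrite muleC lee_wpmul2l ?lee_fin//; apply: NB => //.
      by rewrite normrM ler_pM.
  apply: ge0_subset_integral => //.
  - apply: emeasurable_funM; first exact/measurable_EFinP.
    by apply: measurable_normal_prob => //; exact: measurable_itv.
  - by move=> x _; rewrite mule_ge0// lee_fin.
move: Tin Tout; rewrite -(fineK finI) -(fineK finIc).
set p := fine _; set q := fine _; rewrite -EFinD -!EFinM !lee_fin => pe qe.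
rewrite expr2 -mulrA ler_pM2l ?subr_gt0//.
(* Both products meet at [e * (1 - e) * eK], so [(1 - e) * q <= e * p]: the interval [I] keeps a
   fraction [1 - e] of the tilted mass. *)
have : (e * p >= e * (eK * (1 - e)))%R by rewrite ler_pM2l.
have : ((1 - e) * q <= (1 - e) * (eK * e))%R by rewrite ler_pM2l ?subr_gt0.
lra.
Qed.
End Filters.

(** * Tightness of the filters *)

Section Tightness.
Context {R : realType}.
Variables (rho sigma c : R).
Hypotheses (sigma_gt0 : (0 < sigma)%R) (c_gt0 : (0 < c)%R).
Variable eta1 : probability (measurableTypeR R) R.
Implicit Types (a b s x z : R) (A : set (measurableTypeR R)).

(** The constant [W] of the iterate cancels between numerator and normalisation. The bounds on [s]
    and [a] come from the invariant of [Qpow_gaussian] and do not depend on [k]. *)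
Lemma filtering_mixture (F : probability (measurableTypeR R) R) k :
  (forall A, measurable A -> filter1 c eta1 A = F A) ->
  exists b a s, [/\ (0 <= b)%R, (0 < s)%R, (s ^+ 2 <= c^-1)%R &
    (`|a| <= 2 + rho ^+ 2 / sigma ^+ 2 / c)%R] /\
  forall A, measurable A -> filtering rho sigma c eta1 k.+1 A =
    \int[F]_x ((expR (- (b * x ^+ 2 / 2)))%:E * normal_prob (a * x) s A) /
    \int[F]_x (expR (- (b * x ^+ 2 / 2)))%:E.
Proof.
move=> FE; have [W [b [a [s [[W0 b0 s0] [inv bb QE]]]]]] := Qpow_gaussian rho sigma_gt0 c_gt0 k.
have cb0 : (0 < c + b)%R by rewrite ltr_pwDl.
exists b, a, s; split.
  have a0 : (0 <= a ^+ 2 / (c + b))%R by rewrite divr_ge0 ?sqr_ge0// ltW.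
  split => //; first by move: inv a0; lra.
  have : (a ^+ 2 / (c + b) <= c^-1)%R by have := sqr_ge0 s; lra.
  rewrite ler_pdivrMr// mulrDr mulVf ?gt_eqF// => a2.
  have : (c^-1 * b <= rho ^+ 2 / sigma ^+ 2 / c)%R.
    by rewrite mulrC ler_pM2r// invr_gt0.
  (* So far [a ^+ 2 <= 1 + b / c]; the inequality [2 * |a| <= 1 + a ^+ 2] turns this into a bound on
     [|a|] without square roots. *)
  have := sqr_ge0 (`|a| - 1)%R; rewrite sqrrB1 real_normK ?num_real//.
  have := normr_ge0 a; nra.
have [T T0 TE] := integral_tilt F b0.
move=> A mA.
have E B : measurable B -> apply_kernel (filter1 c eta1) (Qpow rho sigma c k) B =
    W%:E * \int[F]_x ((expR (- (b * x ^+ 2 / 2)))%:E * normal_prob (a * x) s B).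
  move=> mB; rewrite /apply_kernel.
  transitivity (\int[F]_x Qpow rho sigma c k x B); first exact: eq_on_measurable_integral.
  rewrite -ge0_integralZl//.
  - by apply: eq_integral => x _; rewrite QE// EFinM muleA.
  - apply: emeasurable_funM; last exact: measurable_normal_prob.
    by apply/measurable_EFinP; exact: measurable_tilt.
  - by move=> x _; rewrite mule_ge0// lee_fin expR_ge0.
  - by rewrite lee_fin ltW.
rewrite /= !E//.
have -> : \int[F]_x ((expR (- (b * x ^+ 2 / 2)))%:E * normal_prob (a * x) s setT) = T%:E.
  by rewrite -TE; apply: eq_integral => x _; rewrite probability_setT mule1.
rewrite TE (_ : W%:E * T%:E = (W * T)%:E)// !inver !gt_eqF ?mulr_gt0//.
rewrite muleAC (_ : W%:E * _ = T^-1%:E); first by rewrite muleC.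
by rewrite -EFinM invfM mulVKf ?gt_eqF.
Qed.

Lemma filtering_probability t : exists nu : probability (measurableTypeR R) R,
  forall A, measurable A -> filtering rho sigma c eta1 t A = nu A.
Proof.
have [F FE] := filter1_probability c_gt0 eta1.
case: t => [|k]; first by exists F.
have [b [a [s [[b0 s0 _ _] fE]]]] := filtering_mixture k FE.
have [T T0 TE] := integral_tilt F b0.
have [nu nuE] := @mixture_measure _ _ R _ _ F
  (fun x => expR (- (b * x ^+ 2 / 2)))%R
  (fun x => normal_prob (a * x) s : {measure set (measurableTypeR R) -> \bar R})
  (measurable_tilt b) (fun x => expR_ge0 _)
  (fun A mA => measurable_normal_prob a s0 mA).
have nuT : nu setT = T%:E.
  by rewrite nuE -TE; apply: eq_integral => x _; rewrite /= probability_setT mule1.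
have [G GE] := normalized_measure nuT T0.
by exists G => A mA; rewrite fE// GE nuE TE inver gt_eqF.
Qed.

Lemma predictive_probability t : exists nu : probability (measurableTypeR R) R,
  forall A, measurable A -> predictive rho sigma c eta1 t A = nu A.
Proof.
case: t => [|k]; first by exists eta1.
have [F FE] := filtering_probability k.
have [nu nuE] := @mixture_measure _ _ R _ _ F (fun x => 1%R)
  (fun x => normal_prob (rho * x) sigma : {measure set (measurableTypeR R) -> \bar R})
  (measurable_cst _) (fun x => ler01)
  (fun A mA => measurable_normal_prob rho sigma_gt0 mA).
have nuT : nu setT = 1%:E.
  rewrite nuE; under eq_integral do rewrite /= probability_setT mule1.
  by rewrite integral_cst// mul1e; exact: probability_setT.
have [G GE] := normalized_measure nuT ltr01.
exists G => A mA; rewrite GE nuE invr1 mule1/= /apply_kernel.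
rewrite (@eq_on_measurable_integral _ _ _ _ F)//.
by apply: eq_integral => x _; rewrite mul1e.
Qed.

(** The mixture form is available from index 1 on; leaving out finitely many times is harmless for
    events that must occur infinitely often. *)
Lemma filtering_tight e : (0 < e < 1)%R ->
  exists2 B : R, (0 < B)%R & forall k,
    ((1 - e) ^+ 2)%:E <= filtering rho sigma c eta1 k.+1 `[(- B)%R, B]%classic.
Proof.
move=> e01; have [F FE] := filter1_probability c_gt0 eta1.
have M0 : (0 <= 2 + rho ^+ 2 / sigma ^+ 2 / c)%R.
  by rewrite addr_ge0// divr_ge0 ?(ltW c_gt0)// divr_ge0 ?sqr_ge0.
have S0 : (0 < c^-1)%R by rewrite invr_gt0.
have [B B0 BE] := tilted_mixture_tight F M0 S0 e01.
exists B => // k.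
have [b [a [s [[b0 s0 sS aM] fE]]]] := filtering_mixture k FE.
have [T T0 TE] := integral_tilt F b0.
rewrite fE; last exact: measurable_itv.
have := BE b a s b0 aM s0 sS; rewrite TE => h.
by rewrite inver gt_eqF// lee_pdivlMr.
Qed.

(** The third factor [1 - e] pays for one more kernel: started from the core [-K, K] of the
    preceding filter, its means [rho * x] are bounded. *)
Lemma predictive_tight e : (0 < e < 1)%R ->
  exists2 B : R, (0 < B)%R & forall k,
    ((1 - e) ^+ 3)%:E <= predictive rho sigma c eta1 k.+2 `[(- B)%R, B]%classic.
Proof.
move=> e01; have [e0 e1] := andP e01.
have [K K0 KE] := filtering_tight e01.
have M0 : (0 <= `|rho| * K)%R by rewrite mulr_ge0// ltW.
have S0 : (0 < sigma ^+ 2)%R by rewrite exprn_gt0.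
have [B B0 BE] := normal_core M0 S0 e0.
exists B => // k; have [F FE] := filtering_probability k.+1.
have mB : measurable (`[(- B)%R, B]%classic : set (measurableTypeR R)) by exact: measurable_itv.
have mI : measurable (`[(- K)%R, K]%classic : set (measurableTypeR R)) by exact: measurable_itv.
have mN := measurable_normal_prob rho sigma_gt0 mB.
rewrite [predictive _ _ _ _ _]/= /apply_kernel (@eq_on_measurable_integral _ _ _ _ F)//.
apply: (@le_trans _ _ (\int[F]_(x in `[(- K)%R, K]%classic) (1 - e)%:E)).
  rewrite integral_cst// exprS EFinM lee_pmul2l ?lte_fin ?subr_gt0//.
  by have := KE k; rewrite FE.
apply: (@le_trans _ _ (\int[F]_(x in `[(- K)%R, K]%classic)
    normal_prob (rho * x) sigma `[(- B)%R, B]%classic)).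
  apply: ge0_le_integral => //.
  - by move=> x _; rewrite lee_fin subr_ge0 ltW.
  - exact: measurable_funTS.
  - move=> x; rewrite /= in_itv/= -ler_norml => xK.
    by apply: BE => //; rewrite normrM ler_pM.
exact: ge0_subset_integral.
Qed.
End Tightness.

(** * Escape from an interval *)

Section Escape.
Local Open Scope ring_scope.
Context {R : realType}.
Variable rho : R.

(* [center B x] is the path issued from [x] whose increment at step [j] is
   [push B j], chosen larger than anything reachable by a path that was in
   [-B, B] at some earlier step ([reach B j]); [spread j] bounds the effect of
   increments that exceed the prescribed ones by at most 1. *)
Fixpoint reach (B : R) (j : nat) : R :=
  if j is i.+1 then `|rho| * reach B i + (`|rho| * reach B i + B + 1) else B.

Definition push (B : R) (j : nat) : R := `|rho| * reach B j + B + 1.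

Fixpoint center (B x : R) (j : nat) : R :=
  if j is i.+1 then rho * center B x i + push B i else x.

Fixpoint spread (j : nat) : R := if j is i.+1 then `|rho| * spread i + 1 else 0.

Lemma reach_ge B j : 0 <= B -> B <= reach B j.
Proof.
move=> B0; elim: j => [|j IH] //=.
have : 0 <= `|rho| * reach B j by rewrite mulr_ge0// (le_trans B0).
lra.
Qed.

Lemma push_ge0 B j : 0 <= B -> 0 <= push B j.
Proof.
move=> B0; rewrite /push.
have : 0 <= `|rho| * reach B j by rewrite mulr_ge0// (le_trans B0)// reach_ge.
lra.
Qed.

Lemma spread_ge0 j : 0 <= spread j.
Proof. by elim: j => //= j IH; rewrite addr_ge0// mulr_ge0. Qed.

(** After a visit at step [i] the path is bounded by [reach]; each later increment exceeds the
    largest possible [|rho| * reach] by [B + 1], which throws the path beyond [B]. *)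
Lemma center_escape B x i j : 0 <= B -> `|center B x i| <= B -> (i < j)%N ->
  B < `|center B x j|.
Proof.
move=> B0 xi; have xr k : (i <= k)%N -> `|center B x k| <= reach B k.
  elim: k => [|k IH]; first by rewrite leqn0 => /eqP i0; move: xi; rewrite i0.
  rewrite leq_eqVlt => /predU1P[<-|]; first exact: le_trans xi (reach_ge _ B0).
  rewrite ltnS => /IH xk; rewrite /= (le_trans (ler_normD _ _))// lerD//.
    by rewrite normrM ler_wpM2l.
  by rewrite ger0_norm ?push_ge0.
case: j => // j; rewrite ltnS => /xr xj /=.
have : `|rho * center B x j| <= `|rho| * reach B j by rewrite normrM ler_wpM2l.
rewrite ler_norml => /andP[h _].
by apply: lt_le_trans (ler_norm _); rewrite /push; lra.
Qed.

(* Every particle stays close to the deterministic path [center] issued from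
   one of the [N] initial positions, and each such path meets [-B, B] at most
   once; so [N + 1] successive visits are impossible. *)
Lemma particles_escape (N : nat) (xs : nat -> 'I_N -> R) (B : R) :
  let B' := B + \sum_(i < N.+2) spread i in
  0 <= B ->
  (forall j n, (j <= N)%N -> exists m,
     rho * xs j m + push B' j < xs j.+1 n <= rho * xs j m + (push B' j + 1)) ->
  exists2 j, (j <= N)%N & forall n, B < `|xs j.+1 n|.
Proof.
move=> B' B0 step.
have B'0 : 0 <= B' by rewrite addr_ge0// sumr_ge0// => i _; exact: spread_ge0.
have near_center j n : (j <= N.+1)%N ->
    exists m, `|xs j n - center B' (xs 0 m) j| <= spread j.
  elim: j n => [|j IH] n jN; first by exists n; rewrite subrr normr0.
  have [m /andP[m1 m2]] := step j n jN.
  have [r rE] := IH m (ltnW jN); exists r => /=.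
  rewrite (_ : _ - _ = rho * (xs j m - center B' (xs 0 r) j) +
    (xs j.+1 n - rho * xs j m - push B' j)); last by ring.
  rewrite (le_trans (ler_normD _ _))// lerD//.
    by rewrite normrM ler_wpM2l.
  by rewrite ler_norml; apply/andP; split; lra.
apply: contrapT => /forall2NP nesc.
(* A particle in [-B, B] forces its path into [-B', B'], because [spread j.+1] is one of the terms
   of the sum added to [B]. *)
have visit (j : 'I_N.+1) : exists m, `|center B' (xs 0 m) j.+1| <= B'.
  have [/negP|] := nesc j; first by rewrite -ltnS ltn_ord.
  move=> /existsNP[n /negP]; rewrite -leNgt => xB.
  have [m mE] := near_center j.+1 n (ltn_ord j); exists m.
  rewrite (_ : center _ _ _ = xs j.+1 n - (xs j.+1 n - center B' (xs 0 m) j.+1)); last by ring.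
  rewrite (le_trans (ler_normB _ _))// lerD// (le_trans mE)//.
  rewrite (bigD1 (inord j.+1 : 'I_N.+2))//= inordK ?ltnS//; last by rewrite -ltnS.
  by rewrite lerDl sumr_ge0// => i _; exact: spread_ge0.
have [f fE] := choice visit.
(* An injection from the [N + 1] steps to the [N] starting points is impossible. *)
suff inj_f : injective f.
  by have := leq_card f inj_f; rewrite !card_ord ltnn.
have ne (i j : 'I_N.+1) : (i < j)%N -> f i <> f j.
  move=> ij fij; have := @center_escape B' (xs 0 (f i)) i.+1 j.+1 B'0 (fE i) ij.
  by rewrite fij ltNge fE.
move=> i j fij; apply/val_inj => /=; case: (ltngtP i j) => // ij.
- by have := ne _ _ ij fij.
- by have := ne _ _ ij (esym fij).
Qed.
End Escape.

(** * Generalized inverses and finitely supported laws *)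

Section Quantiles.
Context {R : realType}.
Implicit Types (u x y z : R).

Lemma cvg_interval_harmonic (F : probability (measurableTypeR R) R)
    (b : itv_bound R) x :
  F [set` Interval b (BRight (x + k.+1%:R^-1)%R)] @[k --> \oo] -->
  F [set` Interval b (BRight x)].
Proof.
pose I k : set (measurableTypeR R) := [set` Interval b (BRight (x + k.+1%:R^-1)%R)].
have -> : [set` Interval b (BRight x)] = \bigcap_k I k.
  apply/seteqP; split => [y|y Iy].
    rewrite /= itv_boundlr => /andP[by_ yx] k _; rewrite /I/= itv_boundlr by_/=.
    by apply: le_trans yx _; rewrite bnd_simp lerDl invr_ge0.
  rewrite /= itv_boundlr; apply/andP; split.
    by have := Iy 0%N Logic.I; rewrite /I/= itv_boundlr => /andP[].
  rewrite bnd_simp; apply/ler_addgt0Pr => e e0.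
  have [k ke] : exists k : nat, (k.+1%:R^-1 < e)%R.
    exists (Num.truncn e^-1).
    by rewrite invf_plt ?posrE// truncnS_gt.
  have := Iy k Logic.I; rewrite /I/= itv_boundlr => /andP[_]; rewrite bnd_simp => h.
  by apply: le_trans h _; rewrite lerD2l ltW.
apply: nonincreasing_cvg_mu.
- by rewrite ltey_eq fin_num_measure//; exact: measurable_itv.
- by move=> k; exact: measurable_itv.
- by apply: bigcap_measurable => [|k _]; [exists 0%N|exact: measurable_itv].
- move=> k l kl; apply/subsetPset => y; rewrite /I/= !itv_boundlr => /andP[-> /=].
  rewrite !bnd_simp => h; apply: le_trans h _.
  by rewrite lerD2l lef_pV2 ?posrE// ler_nat.
Qed.

(** The infimum is attained by right continuity of the distribution function. The bounds [0 < u < 1]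
    make the set bounded below and nonempty, so that [inf] is not a default value. *)
Lemma mquantile_le (mu : set (measurableTypeR R) -> \bar R)
    (F : probability (measurableTypeR R) R) u x :
  (forall A, measurable A -> mu A = F A) -> (0 < u < 1)%R ->
  (mquantile mu u <= x)%R = (u%:E <= mu `]-oo, x]%classic).
Proof.
move=> muF /andP[u0 u1].
pose S := [set x : R | u%:E <= F `]-oo, x]%classic].
have -> : mquantile mu u = inf S.
  by congr inf; apply/seteqP; split => y; rewrite /S/= /mcdf muF.
rewrite muF//.
have mono y y' : (y <= y')%R -> F `]-oo, y]%classic <= F `]-oo, y']%classic.
  move=> yy; apply: le_measure; rewrite ?inE; [exact: measurable_itv..|].
  by move=> z; rewrite /= !in_itv/= => zy; exact: le_trans yy.
have S0 : S !=set0.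
  have e0 : (0 < 1 - u)%R by lra.
  have [K K0 FK] := probability_tight F e0.
  exists K; rewrite /S/=; apply: (@le_trans _ _ (1 - (1 - u))%:E).
    by rewrite lee_fin; lra.
  apply: le_trans FK _; apply: le_measure; rewrite ?inE; [exact: measurable_itv..|].
  by move=> z; rewrite /= !in_itv/= => /andP[].
have Slb : has_lbound S.
  have e0 : (0 < u / 2)%R by lra.
  have [K K0 FK] := probability_tight F e0.
  exists (- K)%R => y; rewrite /S/= => uy; rewrite leNgt; apply/negP => yK.
  pose I : set (measurableTypeR R) := `[(- K)%R, K]%classic.
  have mI : measurable I by exact: measurable_itv.
  have : u%:E <= F (~` I).
    apply: le_trans uy _; apply: le_measure; rewrite ?inE.
    - exact: measurable_itv.
    - exact: measurableC.
    - move=> z; rewrite /I/= !in_itv/= => zy /andP[zK _]; lra.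
  rewrite probability_setC// leeBrDr ?fin_num_measure// => h.
  have : (u + (1 - u / 2))%:E <= 1.
    by apply: le_trans h; rewrite EFinD leeD2l.
  by rewrite lee_fin; lra.
have Sinf : S (inf S).
  have := @cvg_interval_harmonic F -oo%O (inf S); apply: cvge_ge.
  apply: nearW => k.
  have [y Sy yk] : exists2 y, S y & (y < inf S + k.+1%:R^-1)%R.
    by apply: inf_adherent; rewrite ?invr_gt0//; split.
  by apply: le_trans (Sy : u%:E <= _) _; exact/mono/ltW.
apply/idP/idP => [h|h]; first exact: le_trans (mono _ _ h).
exact: ge_inf.
Qed.

Lemma finite_mixture_probability (N : nat) (w X : 'I_N -> R) :
  (forall n, (0 <= w n)%R) -> (\sum_n w n = 1)%R ->
  exists F : probability (measurableTypeR R) R,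
    forall A, \sum_(n < N) (w n)%:E * \d_(X n) A = F A.
Proof.
move=> w0 w1.
(* [msum] is indexed by natural numbers; indices from [N] on receive the zero measure. *)
pose m (k : nat) : {measure set (measurableTypeR R) -> \bar R} :=
  if insub k is Some i then mscale (NngNum (w0 i)) \d_(X i : measurableTypeR R) else mzero.
have mE A : msum m N A = \sum_(n < N) (w n)%:E * \d_(X n) A.
  by apply: eq_bigr => n _; rewrite /m valK.
have m1 : msum m N setT = 1%:E.
  rewrite mE -w1 -sumEFin; apply: eq_bigr => n _.
  by rewrite diracT mule1.
have [F FE] := normalized_measure m1 ltr01.
by exists F => A; rewrite FE invr1 mule1; exact/esym/mE.
Qed.
End Quantiles.

(** * A Borel-Cantelli lemma for blocks *)

Section BlockBorelCantelli.
Context d (T : measurableType d) (R : realType) (P : probability T R).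
Variables (A : nat -> set T) (L : nat) (p : R).
Hypothesis mA : forall i, measurable (A i).
Local Notation cap s := (\bigcap_(i in [set` s]) A i).
Local Notation E k := (cap (iota (k * L) L)).
Hypothesis block_indep : forall k (s : seq nat), uniq s ->
  (forall i, i \in s -> (k.+1 * L <= i)%N) ->
  P (E k `&` cap s) = p%:E * P (cap s).

Let mcap (s : seq nat) : measurable (cap s).
Proof. by apply: fin_bigcap_measurable => // i _; exact: mA. Qed.

Fixpoint avoid (K m : nat) : set T :=
  if m is j.+1 then avoid K j `\` E (K + j) else setT.

Let measurable_avoid K m : measurable (avoid K m).
Proof. by elim: m => [|m IH] //=; apply: measurableD => //; exact: mcap. Qed.

(** Induction on [m] with [s] general. Removing the last block is a difference of two events of the
    same shape, the second having the block absorbed into [s], so independence is applied to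
    intersections and never to complements. *)
Let probability_avoid K m (s : seq nat) : uniq s -> (forall i, i \in s -> ((K + m) * L <= i)%N) ->
  P (avoid K m `&` cap s) = ((1 - p) ^+ m)%:E * P (cap s).
Proof.
elim: m s => [|m IH] s us sL.
  by rewrite setTI expr0 mul1e.
have sL' i : i \in s -> ((K + m).+1 * L <= i)%N by rewrite -addnS; exact: sL.
rewrite /= setIDAC setIDA.
transitivity (P (avoid K m `&` cap s) - P (avoid K m `&` cap s `&` E (K + m))).
  apply: measureD; [exact: measurableI|exact: mcap|].
  by rewrite ltey_eq fin_num_measure//; exact: measurableI.
rewrite IH//; last first.
  by move=> i /sL'; apply: leq_trans; rewrite mulSn leq_addl.
have -> : avoid K m `&` cap s `&` E (K + m) =
    avoid K m `&` cap (iota ((K + m) * L) L ++ s).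
  rewrite -setIA; congr (_ `&` _); rewrite setIC -bigcap_setU; congr bigcap.
  by apply/seteqP; split => i; rewrite /= mem_cat => /orP.
rewrite IH; last 2 first.
- rewrite cat_uniq iota_uniq us andbT /=; apply/hasPn => i /sL' Li.
  apply/negP; rewrite mem_iota => /andP[_].
  by rewrite (addnC (_ * _)%N) -mulSn ltnNge Li.
- move=> i; rewrite mem_cat mem_iota => /orP[/andP[]//|/sL'].
  by apply: leq_trans; rewrite mulSn leq_addl.
have -> : cap (iota ((K + m) * L) L ++ s) = E (K + m) `&` cap s.
  rewrite -bigcap_setU; congr bigcap.
  by apply/seteqP; split => i; rewrite /= mem_cat => /orP.
rewrite block_indep//.
have : P (cap s) \is a fin_num by exact: fin_num_measure.
case: (P (cap s)) => // r _; rewrite -!EFinM -EFinB; congr EFin.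
by rewrite exprS; ring.
Qed.

Lemma block_infinitely_often : (0 < p)%R ->
  exists G : set T, [/\ measurable G, P G = 1 &
    forall w, G w -> forall K, exists2 k, (K <= k)%N & E k w].
Proof.
move=> p0.
pose Z K := \bigcap_m avoid K m.
have mZ K : measurable (Z K) by apply: bigcap_measurable => //; exists 0%N.
have avoidE K m : P (avoid K m) = ((1 - p) ^+ m)%:E.
  have := @probability_avoid K m [::] erefl; rewrite set_nil bigcap_set0.
  by rewrite setIT probability_setT mule1; apply.
(* [1 - p] is the probability of avoiding one block, hence nonnegative; the geometric limit below
   needs this. *)
have p1 : (p <= 1)%R.
  have := probability_le1 P (measurable_avoid 0 1).
  have : 0 <= P (avoid 0 1) by [].
  by rewrite avoidE expr1 !lee_fin; lra.
have Z0 K : P (Z K) = 0.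
  apply/eqP; rewrite eq_le measure_ge0 andbT.
  have cv : ((1 - p) ^+ m)%:E @[m --> \oo] --> 0%:E.
    apply: cvg_EFin; first exact: nearW.
    apply: cvg_expr; rewrite ger0_norm; lra.
  move: cv; apply: cvge_ge; apply: nearW => m; rewrite -(avoidE K).
  by apply: le_measure; rewrite ?inE// => w; apply.
exists (~` \bigcup_K Z K); split.
- by apply: measurableC; exact: bigcup_measurable.
- rewrite probability_setC; last exact: bigcup_measurable.
  suff -> : P (\bigcup_K Z K) = 0 by rewrite sube0.
  apply: measure_negligible; first exact: bigcup_measurable.
  by apply: negligible_bigcup => K; apply/(negligibleP P (mZ K)); exact: Z0.
- move=> w nZ K; apply: contrapT => nE; apply: nZ; exists K => // m _.
  elim: m => //= m IH; split => // Ew; apply: nE; exists (K + m)%N => //.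
  exact: leq_addr.
Qed.
End BlockBorelCantelli.

(** * Windows for the mutation points *)

Section Windows.
Context {R : realType}.
Implicit Types (m s x y : R).

(** Makes a mutation an additive increment whose law does not depend on the current position. *)
Lemma normal_prob_shift m s y : (0 < s)%R ->
  normal_prob m s `]-oo, (m + y)%R]%classic = normal_prob 0 s `]-oo, y]%classic.
Proof.
move=> s0; rewrite /normal_prob.
have sN0 : s != 0%R by rewrite gt_eqF.
have dF x : is_derive (x : R^o) 1%R (fun z : R^o => (m + z)%R) 1%R.
  by rewrite -[X in is_derive _ _ _ X]add0r; exact: is_deriveD.
have F'E : ((fun z : R => m + z)^`()%classic = cst 1)%R.
  by apply/funext => x; rewrite derive1E derive_val.
rewrite (@increasing_ge0_integration_by_substitutionNy _ (fun z => m + z)%R (normal_pdf m s) y).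
- apply: eq_integral => x _; congr EFin; rewrite F'E !fctE mulr1.
  by rewrite !normal_pdfE// /normal_fun /= subr0 (addrC m) addrK.
- by move=> x z _ _ xz; rewrite ltrD2l.
- by rewrite F'E => x _; exact: cvg_cst.
- by rewrite F'E; exact: is_cvg_cst.
- by rewrite F'E; exact: cvg_cst.
- split => [x _|]; first by [].
  by apply: cvg_at_left_filter; apply: cvgD; [exact: cvg_cst|exact: cvg_id].
- exact: cvg_addrl_Ny.
- by apply: continuous_subspaceT; exact: continuous_normal_pdf.
- by move=> x _; exact: normal_pdf_ge0.
Qed.

Lemma normal_cdf_lt s x y : (0 < s)%R -> (x < y)%R ->
  normal_prob 0 s `]-oo, x]%classic < normal_prob 0 s `]-oo, y]%classic.
Proof.
move=> s0 xy.
have mI : measurable (`]x, y]%classic : set (measurableTypeR R)) by exact: measurable_itv.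
have -> : `]-oo, y]%classic = `]-oo, x]%classic `|` `]x, y]%classic :> set (measurableTypeR R).
  by rewrite -itv_bndbnd_setU// bnd_simp ltW.
rewrite measureU//; last first.
  by apply/seteqP; split => z //=; rewrite !in_itv/= => -[zx /andP[xz _]]; lra.
rewrite lteDl ?fin_num_measure//.
(* A positive lower bound of the density on the interval, since its points satisfy
   [|z| <= |x| + |y|]. Strictness gives the windows positive probability. *)
pose k := normal_pdf 0 s (`|x| + `|y|)%R.
have k0 : (0 < k)%R.
  by rewrite /k normal_pdfE ?gt_eqF// mulr_gt0 ?expR_gt0// normal_peak_gt0 ?gt_eqF.
apply: (@lt_le_trans _ _ (\int[lebesgue_measure]_(z in `]x, y]%classic) k%:E)).
  rewrite integral_cst//= lebesgue_measure_itv/= lte_fin xy -EFinB -EFinM.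
  by rewrite lte_fin mulr_gt0// subr_gt0.
rewrite /= /normal_prob.
apply: ge0_le_integral => //.
- by move=> z _; rewrite lee_fin ltW.
- by apply/measurable_EFinP/measurable_funTS; exact: measurable_normal_pdf.
- move=> z; rewrite /= in_itv/= => /andP[xz zy].
  rewrite lee_fin /k !normal_pdfE ?gt_eqF// ler_pM2l ?normal_peak_gt0 ?gt_eqF//.
  rewrite /normal_fun ler_expR !subr0 ler_pM2r ?invr_gt0 ?pmulrn_lgt0 ?exprn_gt0//.
  rewrite lerN2 -(real_normK (num_real z)) ler_pXn2r ?nnegrE ?addr_ge0//.
  have := ler_norm x; have := ler_norm (- x)%R; have := ler_norm y.
  have := ler_norm (- y)%R; rewrite !normrN ler_norml => *; apply/andP; split; lra.
Qed.

Lemma uniform_prob_itv x y : (0 <= x)%R -> (x <= y)%R -> (y <= 1)%R ->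
  uniform_prob (@ltr01 R) `]x, y]%classic = (y - x)%:E.
Proof.
move=> x0 xy y1; rewrite /uniform_prob.
rewrite (eq_integral (fun=> 1%:E)) => [|z]; last first.
  rewrite inE/= in_itv/= => /andP[xz zy]; rewrite /uniform_pdf subr0 invr1 ifT//.
  by apply/andP; split; lra.
rewrite integral_cst//= mul1e lebesgue_measure_itv/= lte_fin.
move: xy; rewrite le_eqVlt => /predU1P[->|->]; last by rewrite -EFinB.
by rewrite ltxx subrr.
Qed.
End Windows.

(** * Independent blocks of windows for the uniform points *)

Section BlockEvents.
Context d (Omega : measurableType d) (R : realType) (P : probability Omega R).
Variables (N : nat) (U : nat -> 'I_N -> {RV P >-> R}).
Hypothesis U_indep : independent_sets_of_uniforms U.

Lemma measurable_slice (t : nat) (W : set (measurableTypeR R)) : measurable W ->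
  measurable (\bigcap_n (U t n @^-1` W)).
Proof.
move=> mW; apply: fin_bigcap_measurable => //.
by move=> n _; rewrite -[X in measurable X]setTI; exact: measurable_funP.
Qed.

Lemma slice_sigma (t : nat) (W : set (measurableTypeR R)) : measurable W ->
  g_sigma_preimage (fun n : 'I_N => U t n : Omega -> R) (\bigcap_n (U t n @^-1` W)).
Proof.
move=> mW.
pose G : set (set Omega) :=
  \big[setU/set0]_(i < N) preimage_set_system setT (U t i : Omega -> R) measurable.
suff : measurable ((\bigcap_n (U t n @^-1` W)) : set (g_sigma_algebraType G)) by [].
apply: fin_bigcap_measurable => //.
move=> n _; apply: sub_sigma_algebra; rewrite /G -bigcup_seq.
exists n; first by rewrite /= mem_index_enum.
by exists W => //; rewrite setTI.
Qed.

Lemma probability_slice (t : nat) (W : set (measurableTypeR R)) (q : R) : measurable W ->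
  uniform_prob (@ltr01 R) W = q%:E ->
  P (\bigcap_n (U t n @^-1` W)) = (q ^+ N)%:E.
Proof.
move=> mW Wq; have [dU iU _] := U_indep.
have := iU t (enum 'I_N) (fun n => U t n @^-1` W) (enum_uniq _).
rewrite (_ : [set` enum 'I_N] = setT); last first.
  by apply/seteqP; split => n //= _; rewrite mem_enum.
move=> ->; last by move=> n _; exists W => //; rewrite setTI.
rewrite (eq_bigr (fun=> q%:E)) => [|n _]; last by rewrite -Wq -(dU t n).
rewrite big_const_seq count_predT -cardE card_ord.
by elim: N => //= k ->; rewrite exprS EFinM.
Qed.

Lemma blocks_of_windows (L : nat) (W : nat -> set (measurableTypeR R)) (q : nat -> R) :
  (forall i, measurable (W i)) ->
  (forall i, (0 < q i)%R) ->
  (forall i, uniform_prob (@ltr01 R) (W i) = (q i)%:E) ->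
  exists G : set Omega, [/\ measurable G, P G = 1 &
    forall w, G w -> forall K, exists2 k, (K <= k)%N &
      forall i n, (i < L)%N -> W i (U (k * L + i).+1 n w)].
Proof.
move=> mW q0 Wq.
(* The shift by one skips index 0, which drives no mutation. The windows repeat with period [L], so
   all blocks have the same probability. *)
pose A i := \bigcap_n (U i.+1 n @^-1` W (i %% L)%N).
have mA i : measurable (A i) by exact: measurable_slice.
have PA i : P (A i) = (q (i %% L)%N ^+ N)%:E by exact: probability_slice.
have [_ _ iU] := U_indep.
have capE (s : seq nat) : uniq s -> P (\bigcap_(i in [set` s]) A i) = \prod_(i <- s) P (A i).
  move=> us.
  have := iU (map succn s) (fun t => A t.-1).
  rewrite map_inj_uniq//; last exact: succn_inj.
  rewrite us big_map => /(_ erefl) <-; last first.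
    by move=> _ /mapP[i _ ->]; exact: slice_sigma.
  congr (P _); apply/seteqP; split => w h i /=.
    by move=> /mapP[j js ->]; exact: h.
  by move=> js; apply: (h i.+1); rewrite /= map_f.
pose p := (\prod_(i < L) q i ^+ N)%R.
have [||G [mG PG GE]] := @block_infinitely_often _ _ _ P A L p mA.
- move=> k s us sL; rewrite -bigcap_setU.
  rewrite (_ : _ `|` _ = [set` iota (k * L) L ++ s]); last first.
    by apply/seteqP; split => i; rewrite /= mem_cat => /orP.
  rewrite !capE//; last first.
    rewrite cat_uniq iota_uniq us andbT /=; apply/hasPn => i /sL Li.
    apply/negP; rewrite mem_iota => /andP[_].
    by rewrite (addnC (_ * _)%N) -mulSn ltnNge Li.
  rewrite big_cat/=; congr (_ * _).
  rewrite /p -prodEFin -[X in iota X]addn0 iotaDl big_map -[X in iota _ X]subn0.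
  rewrite -/(index_iota 0 L) big_mkord; apply: eq_bigr => i _.
  by rewrite PA modnMDl modn_small.
- by rewrite prodr_gt0// => i _; rewrite exprn_gt0.
exists G; split => // w Gw K; have [k Kk Ek] := GE w Gw K.
exists k => // i n iL.
have := Ek (k * L + i)%N; rewrite /= mem_iota leq_addr ltn_add2l => /(_ iL n Logic.I).
by rewrite /= modnMDl modn_small.
Qed.
End BlockEvents.

(** * Measurability *)

Section Discrepancy.
Context {R : realType}.
Implicit Types F : probability (measurableTypeR R) R.

Lemma cvg_itv_enlarge F (a b : R) (u v : nat -> R) :
  (forall k, a - k.+1%:R^-1 < u k < a)%R -> (forall k, b < v k < b + k.+1%:R^-1)%R ->
  F `[u k, v k]%classic @[k --> \oo] --> F `[a, b]%classic.
Proof.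
move=> ua vb.
pose I k : set (measurableTypeR R) := `[(a - k.+1%:R^-1)%R, (b + k.+1%:R^-1)%R]%classic.
have IE : `[a, b]%classic = \bigcap_k I k.
  apply/seteqP; split => [y|y Iy]; rewrite /= in_itv/=.
    move=> /andP[ay yb] k _; rewrite /I/= in_itv/=.
    have : (0 <= k.+1%:R^-1 :> R)%R by rewrite invr_ge0.
    by set h := _^-1%R => k0; apply/andP; split; lra.
  have Iyk k : (a - k.+1%:R^-1 <= y <= b + k.+1%:R^-1)%R.
    by have := Iy k Logic.I; rewrite /I/= in_itv.
  have arch (e : R) : (0 < e)%R -> exists k : nat, (k.+1%:R^-1 < e)%R.
    by move=> e0; exists (Num.truncn e^-1); rewrite invf_plt ?posrE// truncnS_gt.
  apply/andP; split; apply/ler_addgt0Pr => e /arch[k];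
    by have /andP[] := Iyk k; set h := _^-1%R => *; lra.
have cvI : F (I k) @[k --> \oo] --> F `[a, b]%classic.
  rewrite IE; apply: nonincreasing_cvg_mu.
  - by rewrite ltey_eq fin_num_measure//; exact: measurable_itv.
  - by move=> k; exact: measurable_itv.
  - by apply: bigcap_measurable => [|k _]; [exists 0%N|exact: measurable_itv].
  - move=> k l kl; apply/subsetPset => y; rewrite /I/= !in_itv/= => /andP[h1 h2].
    have : (l.+1%:R^-1 <= k.+1%:R^-1 :> R)%R by rewrite lef_pV2 ?posrE// ler_nat.
    move: h1 h2; set h := k.+1%:R^-1%R; set h' := l.+1%:R^-1%R => *.
    by apply/andP; split; lra.
have mono (x y x' y' : R) : (x' <= x)%R -> (y <= y')%R ->
    F `[x, y]%classic <= F `[x', y']%classic.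
  move=> xx yy; apply: le_measure; rewrite ?inE; [exact: measurable_itv..|].
  by move=> z; rewrite /= !in_itv/= => /andP[h1 h2]; apply/andP; split; lra.
apply: squeeze_cvge cvI; last exact: cvg_cst.
apply: nearW => k; have /andP[h1 h2] := ua k; have /andP[h3 h4] := vb k.
by rewrite !mono// ltW.
Qed.

(** A closed interval is the limit of strictly larger rational ones. Approximation from inside would
    lose atoms at the endpoints. *)
Lemma lt_discrepancy (F1 F2 : probability (measurableTypeR R) R)
    (mu nu : set (measurableTypeR R) -> \bar R) (y : \bar R) :
  (forall A, measurable A -> mu A = F1 A) -> (forall A, measurable A -> nu A = F2 A) ->
  y < discrepancy mu nu <-> exists p q : rat,
    (ratr p < ratr q :> R)%R /\
    y < `|mu `[ratr p, ratr q]%classic - nu `[ratr p, ratr q]%classic|.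
Proof.
move=> mu1 nu2; split; last first.
  move=> [p [q [pq ypq]]]; apply: lt_le_trans ypq _.
  by apply: ereal_sup_ubound; exists (ratr p), (ratr q).
move=> /ereal_sup_gt[_ [a [b [ab ->]]]].
rewrite mu1 ?nu2; [|exact: measurable_itv..] => yab.
have /choice[p pE] : forall k, exists p : rat, (a - k.+1%:R^-1 < ratr p < a)%R.
  move=> k.
  have [|p] := @rat_in_itvoo R (a - k.+1%:R^-1)%R a; first by rewrite ltrBlDr ltrDl invr_gt0.
  by rewrite in_itv/=; exists p.
have /choice[q qE] : forall k, exists q : rat, (b < ratr q < b + k.+1%:R^-1)%R.
  move=> k.
  have [|p'] := @rat_in_itvoo R b (b + k.+1%:R^-1)%R; first by rewrite ltrDl invr_gt0.
  by rewrite in_itv/=; exists p'.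
apply: contrapT => nE.
suff : `|F1 `[a, b]%classic - F2 `[a, b]%classic| <= y by rewrite leNgt yab.
have : `|F1 `[ratr (p k), ratr (q k)]%classic - F2 `[ratr (p k), ratr (q k)]%classic| @[k --> \oo]
    --> `|F1 `[a, b]%classic - F2 `[a, b]%classic|.
  apply: cvg_abse; apply: cvgeB.
  - by rewrite fin_num_adde_defr// ?fin_numN fin_num_measure//; exact: measurable_itv.
  - exact: (cvg_itv_enlarge pE qE).
  - exact: (cvg_itv_enlarge pE qE).
apply: cvge_le; apply: nearW => k; rewrite leNgt; apply/negP => ky; apply: nE.
exists (p k), (q k); split.
  by have := pE k; have := qE k; lra.
by rewrite mu1 ?nu2//; exact: measurable_itv.
Qed.

End Discrepancy.

Section Measurability.
Context d (T : measurableType d) {R : realType}.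

Lemma infinitely_often_limsup (E : nat -> set T) :
  infinitely_often E = \bigcap_n \bigcup_(t in [set t | (n <= t)%N]) E t.
Proof.
apply/seteqP; split => w.
  move=> /= iE n _.
  have /infinite_setN0[t [Et /= tn]] := infinite_setD iE (finite_II n).
  by exists t => //=; rewrite leqNgt; apply/negP.
move=> Ew /= /finite_seqP[s sE].
have [t /= mt Et] := Ew (\max_(i <- s) i).+1 Logic.I.
have ts : t \in s by have : [set t | E t w] t by []; rewrite sE.
by have := @leq_bigmax_seq _ s xpredT id t ts isT; rewrite leqNgt mt.
Qed.

Lemma measurable_infinitely_often (E : nat -> set T) (n0 : nat) :
  (forall t, (n0 <= t)%N -> measurable (E t)) -> measurable (infinitely_often E).
Proof.
move=> mE; rewrite infinitely_often_limsup.
have -> : \bigcap_n \bigcup_(t in [set t | (n <= t)%N]) E t =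
    \bigcap_n \bigcup_(t in [set t | (maxn n n0 <= t)%N]) E t.
  apply/seteqP; split => w h n _.
    by have [t /= tn Et] := h (maxn n n0) Logic.I; exists t.
  by have [t /=] := h n Logic.I; rewrite geq_max => /andP[tn _] Et; exists t.
apply: bigcap_measurable => [|n _]; first by exists 0%N.
apply: bigcup_measurable => t /=; rewrite geq_max => /andP[_]; exact: mE.
Qed.

Lemma measurable_fun_of_le (X : T -> R) :
  (forall x, measurable [set w | (X w <= x)%R]) ->
  measurable_fun setT (X : T -> measurableTypeR R).
Proof.
move=> mX; apply: (measurability _ (RGenOInfty.measurableE R)) => //.
move=> _ [_ [x ->] <-]; rewrite setTI.
rewrite (_ : X @^-1` _ = ~` [set w | (X w <= x)%R]); first exact: measurableC.
by apply/seteqP; split => w; rewrite /= in_itv/= andbT ltNge => /negP.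
Qed.

Lemma measurable_le_fun (f g : T -> R) :
  measurable_fun setT f -> measurable_fun setT g ->
  measurable [set w | (f w <= g w)%R].
Proof.
move=> mf mg.
have := measurable_fun_ler mf mg measurableT (Y := [set true]) Logic.I.
by rewrite setTI.
Qed.

Variable N : nat.
Implicit Types (X : T -> 'I_N -> R).

Lemma measurable_mixture X (W : T -> 'I_N -> R) (I : set (measurableTypeR R)) :
  (forall n, measurable_fun setT (fun w => W w n)) ->
  (forall n, measurable_fun setT (fun w => X w n : measurableTypeR R)) ->
  measurable I ->
  measurable_fun setT (fun w => \sum_(n < N) (W w n)%:E * \d_(X w n) I).
Proof.
move=> mW mX mI; apply: emeasurable_sum => n.
apply: emeasurable_funM; first exact/measurable_EFinP.
apply/measurable_EFinP.
exact: (@measurableT_comp _ _ _ _ _ _ (\1_I : measurableTypeR R -> R) _ (fun w => X w n)).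
Qed.

(** The superlevel sets are countable unions over rational endpoints. The general weights [W] cover
    both empirical measures. *)
Lemma measurable_ge_discrepancy X (W : T -> 'I_N -> R)
    (mu : T -> set (measurableTypeR R) -> \bar R) (nu : set (measurableTypeR R) -> \bar R)
    (F : probability (measurableTypeR R) R) (kappa : R) :
  (forall n, measurable_fun setT (fun w => W w n)) ->
  (forall n, measurable_fun setT (fun w => X w n : measurableTypeR R)) ->
  (forall w A, mu w A = \sum_(n < N) (W w n)%:E * \d_(X w n) A) ->
  (forall w n, (0 <= W w n)%R) -> (forall w, \sum_n W w n = 1)%R ->
  (forall A, measurable A -> nu A = F A) ->
  measurable [set w | kappa%:E <= discrepancy (mu w) nu].
Proof.
move=> mW mX muE W0 W1 nuF.
have mD : measurable_fun setT (fun w => discrepancy (mu w) nu).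
  apply: (measurability _ (ErealGenOInfty.measurableE R)) => //.
  move=> _ [_ [y ->] <-]; rewrite setTI.
  rewrite (_ : _ @^-1` _ = \bigcup_(p : rat) \bigcup_(q : rat)
     [set w | (ratr p < ratr q :> R)%R /\
        y%:E < `|mu w `[ratr p, ratr q]%classic - nu `[ratr p, ratr q]%classic|]); last first.
    have H w := lt_discrepancy y%:E
      (fun A _ => etrans (muE w A) (svalP (cid (finite_mixture_probability (X w) (W0 w) (W1 w))) A))
      nuF.
    apply/seteqP; split => w /=.
      by rewrite in_itv/= andbT => /H[p [q ?]]; exists p => //; exists q.
    by move=> [p _ [q _ ?]]; rewrite in_itv/= andbT; apply/H; exists p, q.
  apply: bigcupT_measurable_rat => p; apply: bigcupT_measurable_rat => q.
  have [pq|pq] := pselect (ratr p < ratr q :> R)%R; last first.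
    by rewrite (_ : [set _ | _] = set0)//; apply/seteqP; split => // w [].
  have mI : measurable (`[ratr p, ratr q]%classic : set (measurableTypeR R)).
    exact: measurable_itv.
  have mf : measurable_fun setT
      (fun w => `|mu w `[ratr p, ratr q]%classic - nu `[ratr p, ratr q]%classic|).
    apply: measurableT_comp => //; apply: emeasurable_funB => //.
    under eq_fun do rewrite muE.
    exact: measurable_mixture.
  have := emeasurable_fun_o_infty measurableT mf y%:E; rewrite setTI.
  by congr measurable; apply/seteqP; split => w /=; [|case].
have := emeasurable_fun_c_infty measurableT mD kappa%:E.
by rewrite setTI.
Qed.
End Measurability.

(** * The particle system *)

Section Particles.
Context {R : realType}.
Variables (rho sigma c : R).
Hypothesis sigma_gt0 : (0 < sigma)%R.
Variable N : nat.
Hypothesis N_ge1 : (1 <= N)%N.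
Implicit Types (X : 'I_N -> R) (u x y z : R).

Lemma sum_Gpot_gt0 X : (0 < \sum_m Gpot c (X m))%R.
Proof.
rewrite (bigD1 (Ordinal N_ge1))//= ltr_pwDl ?Gpot_gt0// sumr_ge0// => n _.
by rewrite ltW ?Gpot_gt0.
Qed.

Lemma weight_ge0 X n : (0 <= weight c X n)%R.
Proof. by rewrite divr_ge0// ltW ?Gpot_gt0 ?sum_Gpot_gt0. Qed.

Lemma sum_weight X : (\sum_n weight c X n = 1)%R.
Proof. by rewrite -mulr_suml divff// gt_eqF// sum_Gpot_gt0. Qed.

Lemma empiricalE X A :
  empirical X A = \sum_(n < N) (N%:R^-1 : R)%:E * \d_(X n) A.
Proof. by rewrite /empirical ge0_sume_distrr. Qed.

Lemma sum_invN : (\sum_(n < N) N%:R^-1 = 1 :> R)%R.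
Proof.
by rewrite sumr_const card_ord -[LHS]mulr_natl divff// pnatr_eq0 -lt0n.
Qed.

Lemma mquantile_weighted_le X u x : (0 < u < 1)%R ->
  (mquantile (weighted_empirical c X) u <= x)%R =
  (u%:E <= weighted_empirical c X `]-oo, x]%classic).
Proof.
move=> u01; have [F FE] := finite_mixture_probability X (weight_ge0 X) (sum_weight X).
by apply: (mquantile_le (F := F)) => // A _; exact: FE.
Qed.

Lemma mquantile_weighted_mem X u : (0 < u < 1)%R ->
  exists m, mquantile (weighted_empirical c X) u = X m.
Proof.
move=> u01; set q := mquantile _ _.
have uq : u%:E <= weighted_empirical c X `]-oo, q]%classic.
  by rewrite -mquantile_weighted_le.
have [m0 m0q] : exists m, (X m <= q)%R.
  apply: contrapT => /forallNP nX; move: uq; rewrite leNgt => /negP; apply.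
  rewrite /weighted_empirical big1 ?lte_fin; first by case/andP: u01.
  move=> n _; rewrite diracE memNset ?mule0//= in_itv/=; exact: nX.
(* The largest particle below the quantile [q]: no particle lies between it and [q], so the
   distribution function already reaches [u] there. *)
case: (arg_maxP (P := fun m => (X m <= q)%R) X m0q) => m mq mmax.
exists m; apply/eqP; rewrite eq_le mq andbT mquantile_weighted_le//.
apply: le_trans uq _; apply: lee_sum => n _.
apply: lee_wpmul2l; first by rewrite lee_fin weight_ge0.
rewrite !diracE lee_fin.
have [Xq|Xq] := leP (X n) q.
  by rewrite [X n \in `]-oo, X m]%classic]mem_set ?ler_nat ?leq_b1//= in_itv/=; exact: mmax.
by rewrite memNset ?ler0n//= in_itv/= leNgt Xq.
Qed.

Definition normal_cdf y : R := fine (normal_prob 0 sigma `]-oo, y]%classic).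

Lemma normal_cdfE y : (normal_cdf y)%:E = normal_prob 0 sigma `]-oo, y]%classic.
Proof. by rewrite /normal_cdf fineK// fin_num_measure//; exact: measurable_itv. Qed.

Lemma normal_cdf_ge0 y : (0 <= normal_cdf y)%R.
Proof. by rewrite -lee_fin normal_cdfE. Qed.

Lemma normal_cdf_le1 y : (normal_cdf y <= 1)%R.
Proof. by rewrite -lee_fin normal_cdfE probability_le1//; exact: measurable_itv. Qed.

Lemma normal_cdf_homo : {homo normal_cdf : x y / (x < y)%R}.
Proof. by move=> x y xy; rewrite -lte_fin !normal_cdfE normal_cdf_lt. Qed.

Lemma mquantile_Mker_le z u x : (0 < u < 1)%R ->
  (mquantile (Mker rho sigma z) u <= x)%R = (u <= normal_cdf (x - rho * z))%R.
Proof.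
move=> u01; rewrite (mquantile_le (F := normal_prob (rho * z) sigma))//.
rewrite -lee_fin normal_cdfE -(normal_prob_shift (rho * z))//.
by rewrite addrC subrK.
Qed.

(** The uniform points for which the centred normal increment falls in []push, push + 1]]. *)
Definition window (B : R) (i : nat) : set (measurableTypeR R) :=
  `]normal_cdf (push rho B i), normal_cdf (push rho B i + 1)%R]%classic.

Lemma uniform_prob_window B i : uniform_prob (@ltr01 R) (window B i) =
  (normal_cdf (push rho B i + 1) - normal_cdf (push rho B i))%:E.
Proof.
by rewrite uniform_prob_itv ?normal_cdf_ge0 ?normal_cdf_le1// ltW// normal_cdf_homo// ltrDl.
Qed.

Variable eta1 : probability (measurableTypeR R) R.

(** [m] is the ancestor selected by resampling. Nothing else is known about it, but the window alone
    fixes the increment up to 1. *)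
Lemma particle_step (u1 u2 : nat -> 'I_N -> R) B i t n :
  (forall t n, 0 < u1 t n < 1)%R -> (forall t n, 0 < u2 t n < 1)%R ->
  window B i (u2 t.+1 n) ->
  let X := particles rho sigma c eta1 u1 u2 in
  exists m, (rho * X t m + push rho B i < X t.+1 n <= rho * X t m + (push rho B i + 1))%R.
Proof.
move=> u1_01 u2_01; rewrite /window/= in_itv/= => /andP[Wl Wr].
have [m mE] := mquantile_weighted_mem (particles rho sigma c eta1 u1 u2 t) (u1_01 t.+1 n).
exists m; rewrite mE ltNge !mquantile_Mker_le//.
have shift (x y : R) : (x + y - x = y)%R by rewrite addrC addKr.
by rewrite !shift -ltNge Wl.
Qed.

Lemma measurable_normal_cdf : measurable_fun setT normal_cdf.
Proof.
apply: nondecreasing_measurable => // x y.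
by rewrite le_eqVlt => /predU1P[->//|xy]; exact/ltW/normal_cdf_homo.
Qed.

Section Measurability.
Context d (Omega : measurableType d).
Variables U1 U2 : nat -> 'I_N -> Omega -> R.
Hypothesis mU1 : forall t n, measurable_fun setT (U1 t n).
Hypothesis mU2 : forall t n, measurable_fun setT (U2 t n).
Hypothesis U1_01 : forall t n w, (0 < U1 t n w < 1)%R.
Hypothesis U2_01 : forall t n w, (0 < U2 t n w < 1)%R.
Local Notation X := (fun t w =>
  particles rho sigma c eta1 (fun s n => U1 s n w) (fun s n => U2 s n w) t).

Lemma measurable_Gpot : measurable_fun [set: measurableTypeR R] (Gpot c).
Proof. exact: measurable_tilt. Qed.

Lemma measurable_weight (Y : Omega -> 'I_N -> R) n :
  (forall n, measurable_fun setT (fun w => Y w n : measurableTypeR R)) ->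
  measurable_fun setT (fun w => weight c (Y w) n).
Proof.
move=> mY; have mG m : measurable_fun setT (fun w => Gpot c (Y w m)).
  exact: (measurableT_comp measurable_Gpot (mY m)).
have mS : measurable_fun setT (fun w => \sum_m Gpot c (Y w m))%R.
  exact: measurable_sum.
(* The division is rewritten with [expR] and [ln], so that measurability follows by composition. *)
have E : (fun w => weight c (Y w) n) =
    (fun w => Gpot c (Y w n) * expR (- ln (\sum_m Gpot c (Y w m))))%R.
  apply/funext => w; rewrite /weight expRN lnK// posrE; exact: sum_Gpot_gt0.
rewrite E; apply: measurable_funM => //; apply: measurableT_comp => //.
by apply: measurableT_comp => //; apply: measurableT_comp.
Qed.

(** The characterisation of [mquantile _ u <= x] turns each sublevel set into an inequality between
    measurable functions. *)
Lemma measurable_particles t n :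
  measurable_fun setT (fun w => X t w n : measurableTypeR R).
Proof.
elim: t n => [|t IH] n.
  apply: measurable_fun_of_le => x /=.
  pose k := fine (eta1 `]-oo, x]%classic).
  rewrite (_ : [set w | _] = [set w | (U1 0 n w <= k)%R]).
    exact: measurable_le_fun.
  apply/seteqP; split => w /=; rewrite (mquantile_le (F := eta1))// -lee_fin fineK//;
    by rewrite fin_num_measure//; exact: measurable_itv.
pose Z w := mquantile (weighted_empirical c (X t w)) (U1 t.+1 n w).
have mZ : measurable_fun setT (Z : Omega -> measurableTypeR R).
  apply: measurable_fun_of_le => x /=.
  have mF : measurable_fun setT
      (fun w => weighted_empirical c (X t w) (`]-oo, x]%classic : set (measurableTypeR R))).
    apply: measurable_mixture => // m; exact: measurable_weight.
  pose g w := fine (weighted_empirical c (X t w) (`]-oo, x]%classic : set (measurableTypeR R))).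
  rewrite (_ : [set w | _] = [set w | (U1 t.+1 n w <= g w)%R]).
    by apply: measurable_le_fun => //; apply: measurableT_comp.
  apply/seteqP; split => w /=; rewrite /Z mquantile_weighted_le// -lee_fin fineK//.
    have [F FE] := finite_mixture_probability (X t w) (weight_ge0 (X t w)) (sum_weight (X t w)).
    by rewrite /weighted_empirical FE fin_num_measure//; exact: measurable_itv.
  have [F FE] := finite_mixture_probability (X t w) (weight_ge0 (X t w)) (sum_weight (X t w)).
  by rewrite /weighted_empirical FE fin_num_measure//; exact: measurable_itv.
apply: measurable_fun_of_le => x /=.
rewrite (_ : [set w | _] = [set w | (U2 t.+1 n w <= normal_cdf (x - rho * Z w))%R]).
  apply: measurable_le_fun => //.
  apply: (measurableT_comp measurable_normal_cdf).
  by apply: measurable_funB => //; apply: measurable_funM.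
by apply/seteqP; split => w /=; rewrite mquantile_Mker_le.
Qed.

End Measurability.
End Particles.

(** * Recurrence of the escape *)

Section Recurrence.
Context {R : realType} (rho sigma c : R).
Hypothesis sigma_gt0 : (0 < sigma)%R.
Variable eta1 : probability (measurableTypeR R) R.
Context d (Omega : measurableType d) (P : probability Omega R).
Variable N : nat.
Hypothesis N_ge1 : (1 <= N)%N.
Variables U1 U2 : nat -> 'I_N -> {RV P >-> R}.
Hypothesis U1_01 : forall t n w, (0 < U1 t n w < 1)%R.
Hypothesis U2_01 : forall t n w, (0 < U2 t n w < 1)%R.
Hypothesis U2_indep : independent_sets_of_uniforms U2.
Local Notation X := (fun t w =>
  particles rho sigma c eta1 (fun s n => U1 s n w) (fun s n => U2 s n w) t).

Lemma particles_leave_infinitely_often (B : R) : (0 <= B)%R ->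
  exists G : set Omega, [/\ measurable G, P G = 1 &
    forall w, G w -> forall K, exists2 t, (K <= t)%N & forall n, (B < `|X t w n|)%R].
Proof.
move=> B0; pose B' := (B + \sum_(i < N.+2) spread rho i)%R.
pose q i := (normal_cdf sigma (push rho B' i + 1) - normal_cdf sigma (push rho B' i))%R.
have mW i : measurable (window rho sigma B' i) by exact: measurable_itv.
have q0 i : (0 < q i)%R by rewrite subr_gt0 normal_cdf_homo// ltrDl.
have Wq i : uniform_prob (@ltr01 R) (window rho sigma B' i) = (q i)%:E.
  exact: uniform_prob_window.
have [G [mG PG GE]] := blocks_of_windows U2_indep N.+1 mW q0 Wq.
exists G; split => // w Gw K; have [k Kk WE] := GE w Gw K.
(* Block [k] starts at time [k * N.+1]; the windows use the enlarged [B'], as [particles_escape]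
   requires. *)
have [|j jN xB] := @particles_escape R rho N (fun j => X (k * N.+1 + j)%N w) B B0.
  move=> j n jN; rewrite addnS.
  by apply: particle_step => //; apply: WE; rewrite ltnS.
exists (k * N.+1 + j.+1)%N => //.
by rewrite (leq_trans Kk)// (leq_trans (leq_pmulr _ (ltn0Sn N)))// leq_addr.
Qed.

Lemma probability_infinitely_often1 (E : nat -> set Omega) (B : R) (n0 : nat) :
  (0 <= B)%R -> (forall t, (n0 <= t)%N -> measurable (E t)) ->
  (forall t w, (n0 <= t)%N -> (forall n, B < `|X t w n|)%R -> E t w) ->
  P (infinitely_often E) = 1.
Proof.
move=> B0 mE XE.
have [G [mG PG GE]] := particles_leave_infinitely_often B0.
have mIO : measurable (infinitely_often E) by exact: measurable_infinitely_often mE.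
apply/eqP; rewrite eq_le probability_le1//= -PG.
apply: le_measure; rewrite ?inE// => w Gw; rewrite infinitely_often_limsup => n _.
have [t nt tB] := GE w Gw (maxn n n0).
move: nt; rewrite geq_max => /andP[nt n0t].
by exists t => //; exact: XE.
Qed.

End Recurrence.

(** * From the escape of the particles to the almost sure statements *)

Lemma finite_mixture_itv0 (R : realType) (N : nat) (W X : 'I_N -> R) (a b B : R) :
  (forall n, B < `|X n|)%R -> (`|a| <= B)%R -> (`|b| <= B)%R ->
  \sum_(n < N) (W n)%:E * \d_(X n) `[a, b]%classic = 0.
Proof.
move=> XB; rewrite !ler_norml => /andP[a1 a2] /andP[b1 b2].
apply: big1 => n _; rewrite diracE memNset ?mule0//= in_itv/= => /andP[aX Xb].
have := XB n; rewrite ltNge ler_norml => /negP; apply.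
by apply/andP; split; lra.
Qed.

Lemma ge_discrepancy (R : realType) (mu nu : set (measurableTypeR R) -> \bar R) (B kappa : R) :
  (0 < B)%R -> mu `[(- B)%R, B]%classic = 0 ->
  kappa%:E <= nu `[(- B)%R, B]%classic -> kappa%:E <= discrepancy mu nu.
Proof.
move=> B0 mu0 nuk; apply: (@le_trans _ _ `|mu `[(- B)%R, B]%classic - nu `[(- B)%R, B]%classic|).
  by rewrite mu0 sub0e abseN; apply: le_trans nuk _; exact: lee_abs.
by apply: ereal_sup_ubound; exists (- B)%R, B; split => //; lra.
Qed.

Lemma exists_margin (R : realFieldType) (kappa : R) : (0 < kappa)%R -> (kappa < 1)%R ->
  exists e : R, [/\ (0 < e < 1)%R, (kappa <= (1 - e) ^+ 2)%R & (kappa <= (1 - e) ^+ 3)%R].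
Proof.
(* Dictated by Bernoulli's inequality [(1 - e) ^+ 3 >= 1 - 3 * e = kappa]. *)
move=> k0 k1; pose e := ((1 - kappa) / 3)%R; exists e.
have ke : (kappa = 1 - 3 * e)%R by rewrite /e; field.
have e0 : (0 < e)%R by rewrite divr_gt0// subr_gt0.
have e1 : (e < 1)%R by clearbody e; lra.
split; [by rewrite e0 e1| |]; clearbody e; rewrite ke !exprS expr0; nra.
Qed.

Theorem proposition2 (R : realType) (rho sigma c : R)
    (sigma_gt0 : (0 < sigma)%R) (c_gt0 : (0 < c)%R)
    (eta1 : probability (measurableTypeR R) R)
    (d : measure_display) (Omega : measurableType d) (P : probability Omega R)
    (N : nat) (N_ge1 : (1 <= N)%N)
    (U1 U2 : nat -> 'I_N -> {RV P >-> R})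
    (U1_01 : forall t n w, (0 < U1 t n w < 1)%R)
    (U2_01 : forall t n w, (0 < U2 t n w < 1)%R)
    (U2_indep : independent_sets_of_uniforms U2) :
  let X t (w : Omega) : 'I_N -> R :=
    particles rho sigma c eta1 (fun s n => U1 s n w) (fun s n => U2 s n w) t in
  let etaN t w := empirical (X t w) in
  let etahatN t w := weighted_empirical c (X t w) in
  let eta := predictive rho sigma c eta1 in
  let etahat := filtering rho sigma c eta1 in
  (forall a b : R, (a <= b)%R ->
    P (infinitely_often (fun t => [set w | etahatN t w `[a, b]%classic = 0])) = 1 /\
    P (infinitely_often (fun t => [set w | etaN t w `[a, b]%classic = 0])) = 1) /\
  (forall kappa : R, (0 < kappa < 1)%R ->
    P (infinitely_often
      (fun t => [set w | kappa%:E <= discrepancy (etahatN t w) (etahat t)])) = 1 /\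
    P (infinitely_often
      (fun t => [set w | kappa%:E <= discrepancy (etaN t w) (eta t)])) = 1).
Proof.
move=> X etaN etahatN eta etahat.
have mX t n : measurable_fun setT (fun w => X t w n : measurableTypeR R).
  by apply: measurable_particles.
have mWt t n : measurable_fun setT (fun w => weight c (X t w) n).
  exact: measurable_weight.
have mC (n : 'I_N) : measurable_fun setT (fun w : Omega => N%:R^-1 : R)%R by [].
have etaNE t w A : etaN t w A = \sum_(n < N) (N%:R^-1 : R)%:E * \d_(X t w n) A.
  exact: empiricalE.
have etahatNE t w A :
    etahatN t w A = \sum_(n < N) (weight c (X t w) n)%:E * \d_(X t w n) A.
  by [].
have W0 t w n : (0 <= weight c (X t w) n)%R by exact: weight_ge0.
have W1 t w : (\sum_n weight c (X t w) n = 1)%R by exact: sum_weight.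
have invN0 (w : Omega) (n : 'I_N) : (0 <= N%:R^-1 :> R)%R by [].
have invN1 (w : Omega) : (\sum_(n < N) N%:R^-1 = 1 :> R)%R by exact: sum_invN.
have io1 E B n0 := @probability_infinitely_often1 R rho sigma c sigma_gt0
  eta1 d Omega P N N_ge1 U1 U2 U1_01 U2_01 U2_indep E B n0.
split=> [a b ab|kappa /andP[k0 k1]].
  pose B := (`|a| + `|b|)%R.
  have B0 : (0 <= B)%R by rewrite addr_ge0.
  have aB : (`|a| <= B)%R by rewrite lerDl.
  have bB : (`|b| <= B)%R by rewrite lerDr.
  have mI : measurable (`[a, b]%classic : set (measurableTypeR R)) by exact: measurable_itv.
  have meas0 (f : Omega -> \bar R) : measurable_fun setT f -> measurable [set w | f w = 0].
    by move=> mf; have := mf measurableT [set 0] (emeasurable_set1 _); rewrite setTI.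
  split; apply: (io1 _ B 0%N) => //.
  - by move=> t _; apply: meas0; apply: measurable_mixture.
  - by move=> t w _ XB; exact: finite_mixture_itv0 XB aB bB.
  - move=> t _; apply: meas0; rewrite (_ : (fun w => _) = (fun w =>
      \sum_(n < N) (N%:R^-1 : R)%:E * \d_(X t w n) (`[a, b]%classic : set (measurableTypeR R)))).
      exact: measurable_mixture.
    by apply/funext => w; exact: etaNE.
  - by move=> t w _ XB /=; rewrite etaNE; exact: finite_mixture_itv0 XB aB bB.
have [e [e01 ke2 ke3]] := exists_margin k0 k1.
have normB (B : R) : (0 < B)%R -> (`|B| <= B /\ `|(- B)| <= B)%R.
  by move=> B0; rewrite normrN gtr0_norm.
split.
- have [B B0 BE] := filtering_tight rho sigma_gt0 c_gt0 eta1 e01.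
  have [B1 B2] := normB B B0.
  (* The tightness bound of the filters starts at index 1. *)
  apply: (io1 _ B 1%N) => [|t _|t w]; first exact: ltW.
    have [F FE] := filtering_probability rho sigma_gt0 c_gt0 eta1 t.
    exact: (measurable_ge_discrepancy kappa (mWt t) (mX t) (etahatNE t) (W0 t) (W1 t) FE).
  case: t => // t _ XB; apply: (ge_discrepancy B0).
    exact: finite_mixture_itv0 XB B2 B1.
  by apply: le_trans (BE t); rewrite lee_fin.
- have [B B0 BE] := predictive_tight rho sigma_gt0 c_gt0 eta1 e01.
  have [B1 B2] := normB B B0.
  (* The predictor at index [k.+2] comes from the filter at index [k.+1], so its bound starts at
     index 2. *)
  apply: (io1 _ B 2%N) => [|t _|t w]; first exact: ltW.
    have [F FE] := predictive_probability rho sigma_gt0 c_gt0 eta1 t.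
    exact: (measurable_ge_discrepancy kappa mC (mX t) (etaNE t) invN0 invN1 FE).
  case: t => [//|[//|t]] _ XB; apply: (ge_discrepancy B0).
    by rewrite etaNE; exact: finite_mixture_itv0 XB B2 B1.
  by apply: le_trans (BE t); rewrite lee_fin.
Qed.
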